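(* Let $\mathbf T=\{T^t\}_{t\in\mathbb R}$ be a measure-preserving flow on a Lebesgue probability space $(\Omega,\mu)$ with non-atomic measure $\mu$, and let $U_{\mathbf T}^tf=f\circ T^t$ be its unitary Koopman group on $L_2(\Omega,\mu)$. Uniform convergence in von Neumann's ergodic theorem for the group $\{U_{\mathbf T}^t\}_{t\in\mathbb R}$ on the whole space $L_2(\Omega,\mu)$, i.e. $$\|P_{t,s}-P\|_{L_2(\Omega,\mu)\to L_2(\Omega,\mu)}\to0\quad\text{as } t-s\to\infty,$$ takes place if and only if $\mathcal P\in L_\infty(\Omega,\mu)$.
   Context: A flow on $(\Omega,\mu)$ is a one-parameter group of automorphisms (invertible measure-preserving maps) $T^t$ with $(t,\omega)\mapsto T^t\omega$ measurable, so that $\{U_{\mathbf T}^t\}$ is a strongly continuous group of unitary operators. For $f\in L_2(\Omega,\mu)$ and real $t>s$, $P_{t,s}f=\frac1{t-s}\int_s^tU_{\mathbf T}^\tau f\,d\tau$, and $P$ is the orthogonal projection of $L_2(\Omega,\mu)$ onto the subspace of functions fixed by all $U_{\mathbf T}^t$. $\mathcal P(\omega)$ is the period of the point $\omega\in\Omega$ with respect to $\mathbf T$: $\mathcal P(\omega)=\inf\{t>0:\ T^t\omega=\omega\}$, with $\mathcal P(\omega)=\infty$ if $\omega$ is not periodic (so $\mathcal P(\omega)=0$ at fixed points of the flow). *)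

(* Defs.v *)
From HB Require Import structures.
From mathcomp Require Import all_boot all_order all_algebra.
From mathcomp Require Import all_classical all_reals all_analysis.
From mathcomp Require Import measurable_realfun complex.

Set Implicit Arguments.
Unset Strict Implicit.
Unset Printing Implicit Defensive.

Import Order.TTheory GRing.Theory Num.Theory.
Import numFieldNormedType.Exports.

Local Open Scope classical_set_scope.
Local Open Scope ring_scope.

Section LebesgueSpace.
Context (d : measure_display) (Omega : measurableType d) (R : realType).

(* The model of a Lebesgue space: Lebesgue measure on the interval [0, a]
   together with countably many atoms, the n-th one of mass p n (possibly 0)
   and located at -(n + 1), outside of the interval. *)
Definition lebesgue_model (a : {nonneg R}) (p : nat -> {nonneg R}) :
    {measure set (measurableTypeR R) -> \bar R} :=
  measure_add
    (mrestr lebesgue_measure (measurable_itv `[0, a%:num]))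
    (mseries (fun n => mscale (p n) (dirac (- n.+1%:R : measurableTypeR R))) 0).

(* Lebesgue spaces in the sense of Rokhlin: complete and isomorphic mod 0 to a
   model. The sets phi @` (A `\` N) are required to be measurable for the
   completion of the model, which is a measure on Borel sets. That nu is a
   probability measure follows from B = setT. *)
Definition lebesgue_space (mu : probability Omega R) : Prop :=
  measure_is_complete mu /\
  exists (a : {nonneg R}) (p : nat -> {nonneg R}),
  let nu := lebesgue_model a p in
  exists (N : set Omega) (M : set (measurableTypeR R))
    (phi : Omega -> measurableTypeR R),
  [/\ mu.-negligible N, nu.-negligible M, set_bij (~` N) (~` M) phi,
      forall B, measurable B ->
        measurable (phi @^-1` B `\` N) /\ mu (phi @^-1` B `\` N) = nu B
    & forall A, measurable A -> completed_algebra_gen nu (phi @` (A `\` N))].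

Definition non_atomic (mu : probability Omega R) : Prop :=
  forall A, measurable A -> (0 < mu A)%E ->
  exists B, [/\ measurable B, B `<=` A, (0 < mu B)%E & (mu B < mu A)%E].

(* As Omega carries a complete sigma-algebra, measurability of
   (t, w) |-> T t w is understood with respect to the completion of the product
   of Lebesgue measure and mu: the uncompleted product sigma-algebra would
   exclude even the rotation flow of the circle. *)
Record measure_flow (mu : probability Omega R) (T : R -> Omega -> Omega) :
    Prop := MeasureFlow {
  flow0 : forall w, T 0 w = w ;
  flowD : forall t s w, T (t + s) w = T t (T s w) ;
  flow_measurable : forall t, measurable_fun setT (T t) ;
  flow_preserving : forall t A, measurable A -> mu (T t @^-1` A) = mu A ;
  flow_jointly_measurable : forall A, measurable A ->
    completed_algebra_gen (lebesgue_measure \x mu)%E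
      [set x : measurableTypeR R * Omega | A (T x.1 x.2)] }.

(* +oo when w is not periodic, since ereal_inf set0 = +oo *)
Definition period (T : R -> Omega -> Omega) (w : Omega) : \bar R :=
  ereal_inf [set t%:E | t in [set t : R | 0 < t /\ T t w = w]].

(* An element of L_oo is a class of functions modulo mu, so that an extended
   real-valued function belongs to L_oo when it agrees mu-a.e. with a measurable
   essentially bounded real-valued one. *)
Definition in_Linfty (mu : probability Omega R) (f : Omega -> \bar R) : Prop :=
  exists2 g : Omega -> R, g \in Lfun mu +oo%E & {ae mu, forall w, f w = (g w)%:E}.

End LebesgueSpace.

Section ComplexL2.
Context (d : measure_display) (Omega : measurableType d) (R : realType).

Definition Cintegral (d' : measure_display) (X : measurableType d')
    (m : {measure set X -> \bar R}) (D : set X) (f : X -> R[i]) : R[i] :=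
  Complex (\int[m]_(x in D) complex.Re (f x)) (\int[m]_(x in D) complex.Im (f x)).

Definition L2norm (mu : probability Omega R) (f : Omega -> R[i]) : \bar R :=
  Lnorm mu 2%:E (fun w => (Normc.normc (f w))%:E).

(* L_2 is handled through representatives, equality being equality mu-a.e. *)
Definition in_L2 (mu : probability Omega R) (f : Omega -> R[i]) : Prop :=
  [/\ measurable_fun setT (fun w => complex.Re (f w)),
      measurable_fun setT (fun w => complex.Im (f w)) & (L2norm mu f < +oo)%E].

Definition L2inner (mu : probability Omega R) (f g : Omega -> R[i]) : R[i] :=
  Cintegral mu setT (fun w => f w * conjc (g w)).

Definition L2opnorm (mu : probability Omega R)
    (A : (Omega -> R[i]) -> (Omega -> R[i])) : \bar R :=
  ereal_sup [set L2norm mu (A f) |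
    f in [set f | in_L2 mu f /\ (L2norm mu f <= 1)%E]].

Definition koopman (T : R -> Omega -> Omega) (t : R) (f : Omega -> R[i]) :
  Omega -> R[i] := f \o T t.

(* The L_2-valued integral of tau |-> koopman T tau f is computed pointwise. For
   almost every w the integrand is Lebesgue measurable, not necessarily Borel,
   in tau, hence the completed Lebesgue measure. *)
Definition ergodic_average (T : R -> Omega -> Omega) (t s : R)
    (f : Omega -> R[i]) : Omega -> R[i] :=
  fun w => ((t - s)^-1)%:C%C *
    Cintegral completed_lebesgue_measure [set` `[s, t]]
      (fun tau => koopman T tau f w).

Definition flow_fixed (mu : probability Omega R) (T : R -> Omega -> Omega)
    (f : Omega -> R[i]) : Prop :=
  in_L2 mu f /\ forall t, {ae mu, forall w, koopman T t f w = f w}.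

Definition is_fixed_proj (mu : probability Omega R) (T : R -> Omega -> Omega)
    (f g : Omega -> R[i]) : Prop :=
  flow_fixed mu T g /\
  forall h, flow_fixed mu T h -> L2inner mu (fun w => f w - g w) h = 0.

(* A representative of the orthogonal projection of f, which exists for f in
   L_2 and is unique mu-a.e. *)
Definition fixed_proj (mu : probability Omega R) (T : R -> Omega -> Omega)
    (f : Omega -> R[i]) : Omega -> R[i] :=
  xget (fun=> 0) [set g | is_fixed_proj mu T f g].

Definition uniform_ergodic (mu : probability Omega R)
    (T : R -> Omega -> Omega) : Prop :=
  forall e : R, 0 < e -> exists L : R, forall t s : R, s < t -> L < t - s ->
  (L2opnorm mu
     (fun f w => ergodic_average T t s f w - fixed_proj mu T f w)%R < e%:E)%E.

End ComplexL2.

(* Main.v *)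
From mathcomp Require Import all_boot all_order all_algebra.
From mathcomp Require Import all_classical all_reals all_analysis.
From mathcomp Require Import measurable_realfun ess_sup_inf complex ring lra.
Require Import Defs.

Set Implicit Arguments.
Unset Strict Implicit.
Unset Printing Implicit Defensive.

Import Order.TTheory GRing.Theory Num.Theory.
Import numFieldNormedType.Exports.

Local Open Scope classical_set_scope.
Local Open Scope ring_scope.

(** The proof rests on two facts: periodic functions have averages converging to
their mean at an explicit rate, and points that do not return for a long time
carry functions that are nearly constant along orbits and yet orthogonal to all
the fixed functions.

_Bounded period implies uniform convergence._ Suppose that almost every point w
satisfies T p w = w for some p in ]0, M]. Cut the window [s, t] into whole
periods and a remainder: the integral of f along the orbit over [s, t] differs
from (t - s) times the mean over one period by at most twice the integral of |f|
over [s, s + M] ([lint_periodic_mean]). By the Cauchy-Schwarz inequality in time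
and the invariance of mu, the norm in L2 of the difference between the average
and the orbit mean [time_limit] is at most 2 M / (t - s) times the norm of f
([time_limit_L2_dist]). The orbit mean is fixed by the flow
([time_limit_fixed]), and subtracting it from f leaves a function orthogonal to
the fixed functions ([time_limit_pairing]); hence it agrees almost everywhere
with the projection ([fixed_proj_unique]).

_Uniform convergence implies bounded period._ Fix a length l for which averaging
over [0, l] at least halves the norm of every function orthogonal to the fixed
functions ([uniform_gap]). Let A be a set no point of which comes back to A at a
time in ]l, 200 l[. Let X w be the time that the orbit of w spends in A during
[0, 65 l]. Then X and its translate by the time 130 l have disjoint supports, and
their difference f is orthogonal to the fixed functions. Averaging over [0, l]
changes f only through the ends of the two windows. If beta is the squared norm
of the time spent in A during [0, l], the squared norm of f is at least 65 beta,
whereas the gap bounds it by 64 beta. So beta = 0 and A is a null set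
([tower_null]).

It remains to cover by countably many such sets the points that do not return at
any time in [l, 200 l]. The flow is only measurable, so points are compared
through their whole orbits: let u be bounded and injective off a null set, and
let Q w x be the integral of u (T r w) for r in [0, x]. For almost every w,
T s w = w if and only if Q (T s w) = Q w on [0, 1], and
Q (T s w) x = Q w (x + s) - Q w s is Lipschitz in s. By compactness, a point that does not return during [a, b] stays
at a positive distance from itself during [a, b] ([far_intro]); cutting into
cells on which Q is almost constant gives the sets A ([far_cell_separated]). The
same countable conditions show that the period is measurable
([measurable_period]).

_Measurability._ The map (t, w) |-> T t w is measurable for a completed product
only. A function h (T t w) is therefore replaced by a function F (t, w) that is
measurable for the product itself and agrees with it almost everywhere
([version_exists]). For almost every w the
integral of h along the orbit of w is that of F, and the theorems of Fubini and
Tonelli apply to F. *)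

(** * Integration on the line with respect to the completed Lebesgue measure *)

Section line.
Context {R : realType}.
Implicit Types (G H g h : R -> R) (a b c p : R).
Notation leb := (@lebesgue_measure R).
Notation cleb := (@completed_lebesgue_measure R).

Lemma measurable_shift p :
  measurable_fun setT (fun x : measurableTypeR R => x + p : measurableTypeR R).
Proof. by apply: measurable_funD => //; exact: measurable_id. Qed.

Lemma lebesgue_measure_shift p (A : set R) : measurable A ->
  pushforward leb (fun x : measurableTypeR R => x + p : measurableTypeR R) A
  = leb A.
Proof.
move=> mA.
pose m : {mfun measurableTypeR R >-> measurableTypeR R} :=
  mfun_Sub (mem_set (measurable_shift p)).
have E : (m : R -> R) = (fun x => x + p) by rewrite /m mfun_valP.
rewrite -[X in pushforward _ X]E.
apply/esym/(@lebesgue_measure_unique _ (pushforward leb m)) => //= _ [[a b]] _ <-.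
rewrite /pushforward /=.
rewrite (_ : +%R^~ p @^-1` `]a, b] = [set` `]a - p, b - p]]); last first.
  by apply/seteqP; split => x /=; rewrite !in_itv/= ltrBlDr lerBrDr.
rewrite !lebesgue_measure_itv/= !lte_fin ltrD2r.
by case: ifPn => // _; rewrite -!EFinD; congr EFin; lra.
Qed.

Lemma ae_shift p (P : R -> Prop) :
  {ae leb, forall x, P x} -> {ae leb, forall x, P (x + p)}.
Proof.
move=> [N [mN N0 PN]].
exists ((fun x : measurableTypeR R => x + p : measurableTypeR R) @^-1` N); split.
- rewrite -[X in measurable X]setTI; exact: measurable_shift.
- by have := lebesgue_measure_shift p mN; rewrite /pushforward => ->.
- by move=> x /= Px; apply: PN.
Qed.

Lemma leb_ae_imp (P Q : R -> Prop) : (forall x, P x -> Q x) ->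
  {ae leb, forall x, P x} -> {ae leb, forall x, Q x}.
Proof.
by move=> PQ; apply: (@filterS _ _ (ae_filter_ringOfSetsType leb)).
Qed.

Lemma leb_ae_and (P Q : R -> Prop) : {ae leb, forall x, P x} ->
  {ae leb, forall x, Q x} -> {ae leb, forall x, P x /\ Q x}.
Proof.
by move=> Px; apply: (@filterS2 _ _ (ae_filter_ringOfSetsType leb) _ _ _ _ Px).
Qed.

Lemma ae_completed (P : R -> Prop) :
  {ae leb, forall x, P x} -> {ae cleb, forall x, P x}.
Proof.
move=> [N [mN N0 PN]]; exists N; split => //=.
by apply: sub_caratheodory.
Qed.

Lemma id_completed_measurable :
  measurable_fun [set: caratheodory_type (wlength idfun)^*%mu]
   (fun x => x : measurableTypeR R).
Proof. by move=> _ Y mY; rewrite setTI; exact: sub_caratheodory. Qed.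

(** The Lebesgue measure is the image of the completed one by the identity map. *)
Lemma ge0_integral_completed (D : set R) (g : R -> \bar R) :
  measurable D -> measurable_fun D g -> (forall x, D x -> (0 <= g x)%E) ->
  (\int[cleb]_(x in D) g x = \int[leb]_(x in D) g x)%E.
Proof.
move=> mD mg g0.
have := @ge0_integral_pushforward _ _ _ (measurableTypeR R) R _ id_completed_measurable cleb D g mD mg.
move=> <-; last by move=> x /set_mem /g0.
apply: eq_measure_integral; first exact: id_completed_measurable.
by move=> ? A _ _; reflexivity.
Qed.

Lemma integral_completed (D : set R) (g : R -> \bar R) :
  measurable D -> measurable_fun D g ->
  (\int[cleb]_(x in D) g x = \int[leb]_(x in D) g x)%E.
Proof.
move=> mD mg; rewrite integralE [RHS]integralE.
by rewrite !ge0_integral_completed//; 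
  [exact: measurable_funeneg|exact: measurable_funepos].
Qed.

Lemma integral_completed_ae (D : set R) (G g : R -> \bar R) :
  measurable D -> measurable_fun D g -> {ae leb, forall x, G x = g x} ->
  (\int[cleb]_(x in D) G x = \int[leb]_(x in D) g x)%E.
Proof.
move=> mD mg Gg.
have mg' : measurable_fun (D : set (caratheodory_type (wlength idfun)^*%mu)) g.
  by move=> _ Y mY; apply: sub_caratheodory; exact: mg.
have aeGg : ae_eq cleb D g G.
  apply: (@filterS _ _ (ae_filter_ringOfSetsType cleb)) (ae_completed Gg).
  by move=> x ->.
rewrite -integral_completed//; apply: ae_eq_integral => //.
- exact: sub_caratheodory.
- apply: ae_measurable_fun aeGg mg'.
  exact: completed_lebesgue_measure_is_complete.
- apply: (@filterS _ _ (ae_filter_ringOfSetsType cleb)) aeGg.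
  by move=> x + Dx => ->.
Qed.

(** Along an orbit a measurable function is in general Lebesgue measurable and not
Borel, hence the Borel version g. *)
Definition loc_int G := exists g, [/\ measurable_fun setT g,
  {ae leb, forall x, G x = g x} &
  forall a b, leb.-integrable `[a, b] (EFin \o g)].

(** The integral used by [ergodic_average], for real-valued functions. *)
Definition lint G a b : R := \int[cleb]_(x in `[a, b]) G x.

Lemma lint_ae G g : measurable_fun setT g -> {ae leb, forall x, G x = g x} ->
  forall a b, lint G a b = \int[leb]_(x in `[a, b]) g x.
Proof.
move=> mg Gg a b; rewrite /lint /Rintegral; congr fine.
apply: integral_completed_ae => //.
- by apply/measurable_EFinP; exact: measurable_funS mg.
- by apply: leb_ae_imp Gg => x ->.
Qed.

Lemma lint_cat G a b c : loc_int G -> a <= b -> b <= c ->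
  lint G a b + lint G b c = lint G a c.
Proof.
move=> [g [mg Gg ig]] ab bc; rewrite !(lint_ae mg Gg).
have := @Rintegral_itvB R g (BLeft a) (BRight c) b (ig a c).
rewrite !bnd_simp => /(_ ab bc).
rewrite Rintegral_itv_obnd_cbnd; last first.
  by apply: integrableS (ig b c) => //; apply: subset_itvr; rewrite bnd_simp.
move=> <-; lra.
Qed.

Lemma integral_shift p a b (g : R -> \bar R) : measurable_fun setT g ->
  (\int[leb]_(x in `[(a + p)%R, (b + p)%R]) g x = \int[leb]_(x in `[a, b]) g (x + p)%R)%E.
Proof.
have E : (fun x : measurableTypeR R => x + p : measurableTypeR R) @^-1` `[(a + p)%R, (b + p)%R] = `[a, b]%classic.
  by apply/seteqP; split => x /=; rewrite !in_itv/= !lerD2r.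
have P (f : R -> \bar R) : measurable_fun setT f -> (forall x, (0 <= f x)%E) ->
  (\int[leb]_(x in `[(a + p)%R, (b + p)%R]) f x = \int[leb]_(x in `[a, b]) f (x + p)%R)%E.
  move=> mf f0; rewrite -E.
  rewrite -(@ge0_integral_pushforward _ _ _ _ _ _ (measurable_shift p) leb)//.
    apply: eq_measure_integral => [|? A mA _]; first exact: measurable_shift.
    exact/esym/lebesgue_measure_shift.
  exact: measurable_funS mf.
move=> mg; rewrite integralE [RHS]integralE; congr (_ - _)%E.
- rewrite (P _ (measurable_funepos mg) (funepos_ge0 g)).
  by apply: eq_integral => x _; rewrite !funeposE.
- rewrite (P _ (measurable_funeneg mg) (funeneg_ge0 g)).
  by apply: eq_integral => x _; rewrite !funenegE.
Qed.

Lemma loc_int_shift G p : loc_int G -> loc_int (fun x => G (x + p)).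
Proof.
move=> [g [mg Gg ig]]; exists (g \o (fun x => x + p)); split.
- apply: measurableT_comp => //; exact: measurable_shift.
- exact: ae_shift Gg.
- move=> a b; have /integrableP[mg' gfin] := ig (a + p) (b + p).
  apply/integrableP; split.
    apply/measurable_EFinP; apply: (@measurable_funS _ _ _ _ setT) => //.
    apply: measurableT_comp => //; exact: measurable_shift.
  rewrite integral_shift in gfin => //.
  by apply/measurableT_comp => //; exact/measurable_EFinP.
Qed.

Lemma lint_shift G p a b : loc_int G ->
  lint (fun x => G (x + p)) a b = lint G (a + p) (b + p).
Proof.
move=> [g [mg Gg ig]].
rewrite (lint_ae mg Gg) (@lint_ae _ (fun x => g (x + p)))//.
- by rewrite /Rintegral integral_shift//; exact/measurable_EFinP.
- apply: (measurableT_comp mg); exact: measurable_shift.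
- exact: ae_shift Gg.
Qed.

End line.

Section line_integral.
Context {R : realType}.
Implicit Types (G H g h : R -> R) (a b c p : R).
Notation leb := (@lebesgue_measure R).

Lemma loc_intD G H : loc_int G -> loc_int H -> loc_int (fun x => G x + H x).
Proof.
move=> [g [mg Gg ig]] [h [mh Hh ih]]; exists (fun x => g x + h x); split.
- exact: measurable_funD.
- by apply: leb_ae_imp (leb_ae_and Gg Hh) => x [-> ->].
- move=> a b; have mab : measurable (`[a, b] : set (measurableTypeR R)) by [].
  rewrite (_ : _ \o _ = (EFin \o g) \+ (EFin \o h))//.
  exact: (integrableD mab (ig a b) (ih a b)).
Qed.

Lemma loc_intZ c G : loc_int G -> loc_int (fun x => c * G x).
Proof.
move=> [g [mg Gg ig]]; exists (fun x => c * g x); split.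
- exact: measurable_funM.
- by apply: leb_ae_imp Gg => x ->.
- move=> a b; have mab : measurable (`[a, b] : set (measurableTypeR R)) by [].
  rewrite (_ : _ \o _ = (fun x => c%:E * (EFin \o g) x)%E)//.
  exact: (integrableZl mab c (ig a b)).
Qed.

Lemma loc_intB G H : loc_int G -> loc_int H -> loc_int (fun x => G x - H x).
Proof.
move=> lG lH; rewrite (_ : (fun x => _) = fun x => G x + (-1) * H x).
  by apply: loc_intD => //; exact: loc_intZ.
by apply/funext => x; rewrite mulN1r.
Qed.

Lemma loc_int_norm G : loc_int G -> loc_int (fun x => `|G x|).
Proof.
move=> [g [mg Gg ig]]; exists (fun x => `|g x|); split.
- exact: measurableT_comp.
- by apply: leb_ae_imp Gg => x ->.
- by move=> a b; exact: (integrable_norm (ig a b)).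
Qed.

Lemma loc_int_bounded G g K : measurable_fun setT g ->
  {ae leb, forall x, G x = g x} -> (forall x, `|g x| <= K) -> loc_int G.
Proof.
move=> mg Gg gK; exists g; split=> // a b.
apply: measurable_bounded_integrable => //=.
- by rewrite lebesgue_measure_itv/=; case: ifPn => // _; rewrite -EFinB ltry.
- exact: measurable_funS mg.
- exists K; split; first exact: num_real.
  by move=> x Kx y _; apply: le_trans (gK y) _; exact: ltW.
Qed.

Lemma loc_int_cst c : loc_int (fun=> c).
Proof.
by apply: (@loc_int_bounded _ (cst c) `|c|) => //; exact: aeW.
Qed.

Lemma lintD G H a b : loc_int G -> loc_int H ->
  lint (fun x => G x + H x) a b = lint G a b + lint H a b.
Proof.
move=> [g [mg Gg ig]] [h [mh Hh ih]].
rewrite (lint_ae mg Gg) (lint_ae mh Hh) (@lint_ae _ _ (fun x => g x + h x)).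
- by rewrite RintegralD.
- exact: measurable_funD.
- by apply: leb_ae_imp (leb_ae_and Gg Hh) => x [-> ->].
Qed.

Lemma lintZ c G a b : loc_int G ->
  lint (fun x => c * G x) a b = c * lint G a b.
Proof.
move=> [g [mg Gg ig]].
rewrite (lint_ae mg Gg) (@lint_ae _ _ (fun x => c * g x)).
- by rewrite RintegralZl.
- exact: measurable_funM.
- by apply: leb_ae_imp Gg => x ->.
Qed.

Lemma lintB G H a b : loc_int G -> loc_int H ->
  lint (fun x => G x - H x) a b = lint G a b - lint H a b.
Proof.
move=> lG lH; rewrite -mulN1r -lintZ// -lintD//; last exact: loc_intZ.
by congr lint; apply/funext => x; rewrite mulN1r.
Qed.

Lemma lint_cst c a b : a <= b -> lint (fun=> c) a b = c * (b - a).
Proof.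
move=> ab; rewrite (@lint_ae _ _ (cst c))//; last exact: aeW.
rewrite Rintegral_cst//= lebesgue_measure_itv/= lte_fin.
by move: ab; rewrite le_eqVlt => /predU1P[->|->//]; rewrite ltxx subrr.
Qed.

Lemma lint_ge0 G a b : (forall x, a <= x <= b -> 0 <= G x) -> 0 <= lint G a b.
Proof.
by move=> G0; apply: Rintegral_ge0 => x/=; rewrite in_itv/= => /G0.
Qed.

Lemma lint_le G H a b : loc_int G -> loc_int H ->
  (forall x, a <= x <= b -> G x <= H x) -> lint G a b <= lint H a b.
Proof.
move=> lG lH GH; rewrite -subr_ge0 -lintB//; apply: lint_ge0 => x /GH.
by rewrite subr_ge0.
Qed.

Lemma lint_eq G H a b : (forall x, a <= x <= b -> G x = H x) ->
  lint G a b = lint H a b.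
Proof.
by move=> GH; apply: eq_Rintegral => x; rewrite inE/= in_itv/= => /GH.
Qed.

Lemma lint_norm G a b : loc_int G -> `|lint G a b| <= lint (fun x => `|G x|) a b.
Proof.
move=> lG; rewrite ler_norml; apply/andP; split.
  rewrite lerNl -mulN1r -lintZ//; apply: lint_le.
  - exact: loc_intZ.
  - exact: loc_int_norm.
  - by move=> x _; rewrite mulN1r lerNl lerNnormlW.
by apply: lint_le => //; [exact: loc_int_norm|move=> x _; exact: ler_norm].
Qed.

Lemma lint_widen G a b a' b' : loc_int G -> (forall x, 0 <= G x) ->
  a' <= a -> a <= b -> b <= b' -> lint G a b <= lint G a' b'.
Proof.
move=> lG G0 aa ab bb.
rewrite -(lint_cat lG aa (le_trans ab bb)) -(lint_cat lG ab bb).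
by rewrite addrCA lerDl addr_ge0// lint_ge0.
Qed.

(** Cauchy-Schwarz against the constant 1: integrate the square of G - m, where
   m is the mean of G. *)
Lemma lint_sqr G a b : loc_int G -> loc_int (fun x => G x ^+ 2) -> a < b ->
  lint G a b ^+ 2 <= (b - a) * lint (fun x => G x ^+ 2) a b.
Proof.
move=> lG lG2 ab; have ba0 : 0 < b - a by rewrite subr_gt0.
set m := lint G a b / (b - a).
have : 0 <= lint (fun x => (G x - m) ^+ 2) a b.
  by apply: lint_ge0 => x _; exact: sqr_ge0.
rewrite (_ : (fun x => _) = (fun x => G x ^+ 2 - (2 * m * G x - m ^+ 2))); last first.
  by apply/funext => x; ring.
have lmG : loc_int (fun x => 2 * m * G x) by exact: loc_intZ.
have lm : loc_int (fun=> m ^+ 2) by exact: loc_int_cst.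
rewrite lintB//; last exact: loc_intB.
rewrite lintB// lintZ// lint_cst; last exact: ltW.
have -> : lint G a b = m * (b - a) by rewrite /m divfK// gt_eqF.
move=> ge0; rewrite (_ : (m * (b - a)) ^+ 2 = (b - a) * (m ^+ 2 * (b - a))); last by ring.
rewrite ler_wpM2l//; first exact: ltW.
by rewrite -subr_ge0; apply: le_trans ge0 _; rewrite le_eqVlt; apply/orP; left; apply/eqP; ring.
Qed.

(** The Lebesgue differentiation theorem applied to the primitive of G. *)
Lemma lint_eq0_ae G : loc_int G -> (forall x, 0 <= x <= 1 -> lint G 0 x = 0) ->
  {ae leb, forall x, 0 < x < 1 -> G x = 0}.
Proof.
move=> [g [mg Gg ig]] G0.
pose g1 := g \_ `[0, 1].
have ig1 : leb.-integrable setT (EFin \o g1).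
  rewrite /g1 -restrict_EFin; apply/integrable_restrict => //=.
  by rewrite setTI; exact: ig.
have := @FTC1 R g1 (BLeft 0).
have ly y : leb.-integrable [set` Interval (BLeft 0) (BRight y)] (EFin \o g1).
  by apply: integrableS ig1 => //; exact: measurableT.
have lg1 : locally_integrable setT g1.
  by apply: open_integrable_locally => //; exact: openT.
move=> /(_ ly lg1) /= h.
apply: leb_ae_imp (leb_ae_and Gg h) => x [-> +] /andP[x0 x1].
move=> /(_ x0) [_].
rewrite {2}/g1 patchE mem_set/=; last by rewrite in_itv/= !ltW.
move=> <-.
rewrite derive1E (near_eq_derive (g := cst 0)) ?derive_cst//.
near=> y => /=; transitivity (lint G 0 y); last first; first apply: G0.
  by apply/andP; split; apply: ltW; near: y; [exact: lt_nbhsr|exact: lt_nbhsl].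
rewrite (lint_ae mg Gg); apply: eq_Rintegral => z; rewrite inE/= in_itv/= => zy.
rewrite /g1 patchE mem_set//= in_itv/=.
have : y <= 1 by apply: ltW; near: y; exact: lt_nbhsl.
by case/andP: zy => -> zy /(le_trans zy) ->.
Unshelve. all: by end_near. Qed.
End line_integral.

(** * Completed products *)

Section completion.
Context d (X : measurableType d) (R : realType) (nu : {measure set X -> \bar R}).

(** For each rational q, the set where G exceeds q is measurable up to a null set;
off the union of these countably many null sets, G is measurable. *)
Lemma completed_measurable_ae (G : X -> R) :
  (forall B : set R, measurable B -> completed_algebra_gen nu (G @^-1` B)) ->
  exists F : X -> R, measurable_fun setT F /\ {ae nu, forall x, G x = F x}.
Proof.
move=> cG.
have /choice[AN ANP] (q : rat) : exists AN : set X * set X,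
    [/\ measurable AN.1, nu.-negligible AN.2 &
        AN.1 `|` AN.2 = G @^-1` `]ratr q, +oo[].
  have [|A mA [N nN ANE]] := cG `]ratr q, +oo[%classic; first exact: measurable_itv.
  by exists (A, N).
pose N := \bigcup_n (if unpickle n is Some q then (AN q).2 else set0).
have [Z [mZ Z0 NZ]] : nu.-negligible N.
  apply: negligible_bigcup => n; case: (unpickle n) => [q|].
    by have [] := ANP q.
  exact: negligible_set0.
have {}NZ q : (AN q).2 `<=` Z.
  move=> x xq; apply: NZ; exists (pickle q); first exact: I.
  by rewrite pickleK.
exists (fun x => if x \in Z then 0 else G x); split; last first.
  exists Z; split => // x /=; apply: contra_notP => xZ.
  by rewrite memNset.
apply: (measurability _ (RGenOInfty.measurableE R)) => //.
move=> _ [_ [a ->] <-]; rewrite setTI.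
rewrite (_ : _ @^-1` _ =
  (\bigcup_(q in [set q : rat | a < ratr q]) ((AN q).1 `\` Z)) `|`
  (if a < 0 then Z else set0)); last first.
  apply/seteqP; split => x /=; rewrite ?in_itv/= ?andbT.
    case: ifPn => xZ ax; first by right; rewrite ax; exact: set_mem.
    left; have [q /andP[aq qx]] := rat_in_itvoo ax.
    exists q => //; split; last by move/negP: xZ => + /mem_set.
    have [_ _] := ANP q => /seteqP[_ /(_ x)] /=; rewrite in_itv/= andbT.
    by move=> /(_ qx)[//|/NZ /mem_set]; rewrite (negbTE xZ).
  move=> [[q /= aq [Ax nZ]]|].
    rewrite memNset//; apply: (lt_trans aq).
    have [_ _ /seteqP[+ _]] := ANP q.
    by move=> /(_ x (or_introl Ax)); rewrite /= in_itv/= andbT.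
  by case: ifPn => // a0 Zx; rewrite mem_set.
apply: measurableU; last by case: ifPn.
rewrite bigcup_mkcond; apply: bigcupT_measurable_rat => q; case: ifPn => // _.
by apply: measurableD => //; have [] := ANP q.
Qed.

End completion.

Section slices.
Context d1 d2 (X : measurableType d1) (Y : measurableType d2) (R : realType).
Context (m1 : {sigma_finite_measure set X -> \bar R}).
Context (m2 : {sigma_finite_measure set Y -> \bar R}).

Lemma ge0_integral0_ae d (Z : measurableType d) (m : {measure set Z -> \bar R})
    (f : Z -> \bar R) : measurable_fun setT f -> (forall x, 0 <= f x)%E ->
  (\int[m]_x f x = 0)%E -> {ae m, forall x, f x = 0%E}.
Proof.
move=> mf f0 If.
have := (ae_eq_integral_abs m measurableT mf).1.
under eq_integral do rewrite gee0_abs//.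
move=> /(_ If); apply: filterS => x; exact.
Qed.

(** The exceptional set lies in a null measurable set, almost all of whose slices
are null by Tonelli's theorem. *)
Lemma ae_slices (P : X * Y -> Prop) : {ae (m1 \x m2)%E, forall z, P z} ->
  {ae m1, forall x, {ae m2, forall y, P (x, y)}} /\
  {ae m2, forall y, {ae m1, forall x, P (x, y)}}.
Proof.
move=> [Z [mZ Z0 PZ]]; split.
- have : {ae m1, forall x, m2 (xsection Z x) = 0%E}.
    apply: ge0_integral0_ae => //; exact: measurable_fun_xsection.
  apply: filterS => x Zx; exists (xsection Z x); split => //.
    exact: measurable_xsection.
  by move=> y /= nP; rewrite /xsection/= inE; exact: PZ.
- have : {ae m2, forall y, m1 (ysection Z y) = 0%E}.
    apply: ge0_integral0_ae => //; first exact: measurable_fun_ysection.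
    have := indic_fubini_tonelli m1 m2 mZ.
    rewrite indic_fubini_tonelli_FE// indic_fubini_tonelli_GE// => <-.
    exact: Z0.
  apply: filterS => y Zy; exists (ysection Z y); split => //.
    exact: measurable_ysection.
  by move=> x /= nP; rewrite /ysection/= inE; exact: PZ.
Qed.
End slices.

(** * Borel versions of functions along the orbits *)

Section flow.
Context d (Omega : measurableType d) (R : realType).
Context (mu : probability Omega R) (T : R -> Omega -> Omega).
Hypothesis mu_complete : measure_is_complete mu.
Hypothesis flowT : measure_flow mu T.
Notation leb := (@lebesgue_measure R).
Implicit Types (h k : Omega -> R) (F : measurableTypeR R * Omega -> R).

Definition version h F := measurable_fun setT F /\
  {ae (leb \x mu)%E, forall z, h (T z.1 z.2) = F z}.

Lemma version_exists h : measurable_fun setT h -> exists F, version h F.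
Proof.
move=> mh.
apply: (@completed_measurable_ae _ _ _ (leb \x mu)%E (fun z => h (T z.1 z.2))).
move=> B mB; apply: (flow_jointly_measurable flowT (A := h @^-1` B)).
by rewrite -[X in measurable X]setTI; exact: mh.
Qed.

Lemma version_slice_measurable h F : version h F ->
  forall w, measurable_fun setT (fun r : measurableTypeR R => F (r, w)).
Proof. by move=> [mF _] w; exact: measurableT_comp. Qed.

Lemma version_orbit h F : version h F ->
  {ae mu, forall w, {ae leb, forall r, h (T r w) = F (r, w)}}.
Proof. by move=> [_ hF]; have [_] := ae_slices hF. Qed.

Lemma version_time h F : version h F ->
  {ae leb, forall r, {ae mu, forall w, h (T r w) = F (r, w)}}.
Proof. by move=> [_ hF]; have [] := ae_slices hF. Qed.

Lemma version_map (phi : R -> R) h F : measurable_fun setT phi ->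
  version h F -> version (phi \o h) (phi \o F).
Proof.
move=> mphi [mF hF]; split; first exact: measurableT_comp.
by apply: (@filterS _ _ (ae_filter_ringOfSetsType (leb \x mu)%E)) hF => z /= ->.
Qed.

Lemma ge0_integral_flow (h : Omega -> \bar R) r : measurable_fun setT h ->
  (forall w, 0 <= h w)%E -> (\int[mu]_w h (T r w) = \int[mu]_w h w)%E.
Proof.
move=> mh h0; have mT := flow_measurable flowT r.
rewrite -(@ge0_integral_pushforward _ _ _ _ _ _ mT mu setT h)//.
apply: eq_measure_integral => A mA _.
exact: (flow_preserving flowT).
Qed.

Lemma integral_flow (h : Omega -> \bar R) r : mu.-integrable setT h ->
  (\int[mu]_w h (T r w) = \int[mu]_w h w)%E.
Proof.
move=> ih; rewrite integralE [RHS]integralE; have mh := measurable_int _ ih.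
congr (_ - _)%E.
- rewrite -(ge0_integral_flow r (measurable_funepos mh) (funepos_ge0 h)).
  by apply: eq_integral => x _; rewrite !funeposE.
- rewrite -(ge0_integral_flow r (measurable_funeneg mh) (funeneg_ge0 h)).
  by apply: eq_integral => x _; rewrite !funenegE.
Qed.

(** For almost every r the slice of F at time r is almost everywhere h \o T r, whose
integral does not depend on r. *)
Lemma tonelli_flow h F a b : a <= b -> measurable_fun setT h ->
  (forall w, 0 <= h w) -> version h F -> (forall z, 0 <= F z) ->
  (\int[mu]_w \int[leb]_(r in `[a, b]) (F (r, w))%:E =
   (b - a)%:E * \int[mu]_w (h w)%:E)%E.
Proof.
move=> ab mh h0 vF F0; have [mF _] := vF.
pose f (z : measurableTypeR R * Omega) := (F z * \1_`[a, b] z.1)%:E.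
have mf : measurable_fun setT f.
  apply/measurable_EFinP; apply: measurable_funM => //.
  by apply: (measurableT_comp (measurable_indic _)) => //; exact: measurable_fst.
have f0 z : (0 <= f z)%E by rewrite lee_fin mulr_ge0.
transitivity (\int[mu]_w \int[leb]_r f (r, w))%E.
  apply: eq_integral => w _; rewrite integral_mkcond; apply: eq_integral => r _.
  by rewrite /f patchE indicE; case: ifPn; rewrite ?mulr1 ?mulr0.
rewrite -(fubini_tonelli f)//.
transitivity (\int[leb]_(r in `[a, b]) \int[mu]_w (F (r, w))%:E)%E.
  rewrite [RHS]integral_mkcond; apply: eq_integral => r _.
  rewrite patchE; case: ifPn => rab.
    by apply: eq_integral => w _; rewrite /f indicE/= rab mulr1.
  by apply: integral0_eq => w _; rewrite /f indicE/= (negbTE rab) mulr0.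
have mG : measurable_fun setT (fun r => \int[mu]_w (F (r, w))%:E)%E.
  apply: (measurable_fun_fubini_tonelli_F (m2 := mu) (EFin \o F)).
    exact/measurable_EFinP.
  by move=> z; exact: F0.
have -> : (\int[leb]_(r in `[a, b]) \int[mu]_w (F (r, w))%:E =
  \int[leb]_(r in `[a, b]) cst (\int[mu]_w (h w)%:E) r)%E.
  apply: ge0_ae_eq_integral => //=.
  - exact: measurable_funS mG.
  - by move=> x _; apply: integral_ge0 => w _; rewrite lee_fin.
  - by move=> x _; apply: integral_ge0 => w _; rewrite lee_fin.
  - apply: leb_ae_imp (version_time vF) => r hr _.
    rewrite -(@ge0_integral_flow (EFin \o h) r)//; last first.
      exact/measurable_EFinP.
    apply: ge0_ae_eq_integral => //=.
    + apply/measurable_EFinP; exact: measurableT_comp.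
    + apply/measurable_EFinP; apply: measurableT_comp => //.
      exact: (flow_measurable flowT).
    + by move=> w _; rewrite lee_fin.
    + by move=> w _; rewrite lee_fin.
    + by apply: filterS hr => w ->.
rewrite integral_cst//= muleC; congr (_ * _)%E.
rewrite lebesgue_measure_itv/= lte_fin.
by move: ab; rewrite le_eqVlt => /predU1P[->|->//]; rewrite ltxx subrr.
Qed.
End flow.

(** * Real-valued square-integrable functions and their orbit integrals *)

Section real_L2.
Context d (X : measurableType d) (R : realType).
Context (mu : {measure set X -> \bar R}).
Implicit Types f g : X -> R.

Definition L2R f := measurable_fun setT f /\
  mu.-integrable setT (fun x => (f x ^+ 2)%:E).

Lemma L2R_le f g : measurable_fun setT f -> L2R g ->
  {ae mu, forall x, f x ^+ 2 <= g x ^+ 2} -> L2R f.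
Proof.
move=> mf [mg ig] fg; split => //.
have mf2 : measurable_fun setT (fun x => (f x ^+ 2)%:E).
  by apply/measurable_EFinP; exact: measurable_funX.
have mg2 := measurable_int _ ig.
apply/integrableP; split => //.
move/integrableP : ig => [_]; apply: le_lt_trans.
apply: ae_ge0_le_integral => //; try exact: measurableT_comp.
apply: filterS fg => x fg _; rewrite lee_fin.
by rewrite !ger0_norm ?sqr_ge0.
Qed.

Lemma L2R_mul f g : L2R f -> L2R g -> mu.-integrable setT (fun x => (f x * g x)%:E).
Proof.
move=> [mf if2] [mg ig2].
apply: (le_integrable measurableT _ _ (integrableD measurableT if2 ig2)).
  by apply/measurable_EFinP; exact: measurable_funM.
move=> x _ /=; rewrite lee_fin.
rewrite [leRHS]ger0_norm ?addr_ge0 ?sqr_ge0// normrM.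
rewrite -(real_normK (num_real (f x))) -(real_normK (num_real (g x))).
have := sqr_ge0 (`|f x| - `|g x|); have := sqr_ge0 (`|f x|); have := sqr_ge0 (`|g x|).
nra.
Qed.

Lemma L2RZ c f : L2R f -> L2R (fun x => c * f x).
Proof.
move=> [mf if2]; split; first exact: measurable_funM.
rewrite (_ : (fun _ => _) = (fun x => (c ^+ 2)%:E * (f x ^+ 2)%:E)%E).
  exact: integrableZl.
by apply/funext => x; rewrite exprMn.
Qed.

Lemma L2RD f g : L2R f -> L2R g -> L2R (fun x => f x + g x).
Proof.
move=> Lf Lg; split; first by case: Lf Lg => ? _ [? _]; exact: measurable_funD.
rewrite (_ : (fun _ => _) =
    (fun x => (f x ^+ 2)%:E + (g x ^+ 2)%:E + 2%:E * (f x * g x)%:E)%E).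
  apply: integrableD => //; last by apply: integrableZl => //; exact: L2R_mul.
  by apply: integrableD => //; [case: Lf|case: Lg].
by apply/funext => x; rewrite -EFinM -!EFinD; congr EFin; ring.
Qed.

Lemma L2RB f g : L2R f -> L2R g -> L2R (fun x => f x - g x).
Proof.
move=> Lf Lg; rewrite (_ : (fun x => _) = fun x => f x + (-1) * g x).
  by apply: L2RD => //; exact: L2RZ.
by apply/funext => x; rewrite mulN1r.
Qed.

Lemma L2R_norm f : L2R f -> L2R (fun x => `|f x|).
Proof.
move=> [mf if2]; split; first exact: measurableT_comp.
by rewrite (_ : (fun _ => _) = (fun x => (f x ^+ 2)%:E))//; apply/funext => x; rewrite real_normK ?num_real.
Qed.

End real_L2.

Section orbit_versions.
Context d (Omega : measurableType d) (R : realType).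
Context (mu : probability Omega R) (T : R -> Omega -> Omega).
Hypothesis mu_complete : measure_is_complete mu.
Hypothesis flowT : measure_flow mu T.
Notation leb := (@lebesgue_measure R).
Implicit Types (h k : Omega -> R) (F : measurableTypeR R * Omega -> R).
Notation version := (version mu T).
Notation orb h w := (fun r : R => h (T r w)).

Lemma measurable_complete h g : measurable_fun setT g ->
  {ae mu, forall w, h w = g w} -> measurable_fun setT h.
Proof.
move=> mg hg; apply/measurable_EFinP.
apply: (ae_measurable_fun mu_complete (f := EFin \o g)).
  by apply: filterS hg => w /= ->.
exact/measurable_EFinP.
Qed.

(** By Tonelli's theorem the square of F has finite integral over the window [- n, n]
of almost every orbit; one null set serves all n. *)
Lemma version_L2 h F : L2R mu h -> version h F ->
  {ae mu, forall w, [/\ {ae leb, forall r, h (T r w) = F (r, w)},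
    (forall a b, leb.-integrable `[a, b] (fun r => (F (r, w))%:E)) &
    (forall a b, leb.-integrable `[a, b] (fun r => (F (r, w) ^+ 2)%:E))]}.
Proof.
move=> [mh ih2] vF; have [mF _] := vF.
have mF2 : measurable_fun setT (fun z => F z ^+ 2) by exact: measurable_funX.
have vF2 : version (fun w => h w ^+ 2) (fun z => F z ^+ 2).
  exact: (version_map (phi := fun x => x ^+ 2) _ vF).
have fin n : {ae mu, forall w,
    (\int[leb]_(r in `[(- n%:R)%R, n%:R%R]) (F (r, w) ^+ 2)%:E < +oo)%E}.
  pose f (z : measurableTypeR R * Omega) := (F z ^+ 2 * \1_`[(- n%:R)%R, n%:R%R] z.1)%:E.
  have mf : measurable_fun setT f.
    apply/measurable_EFinP; apply: measurable_funM => //.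
    by apply: (measurableT_comp (measurable_indic _)) => //; exact: measurable_fst.
  have fE w : (\int[leb]_(r in `[(- n%:R)%R, n%:R%R]) (F (r, w) ^+ 2)%:E =
      \int[leb]_r f (r, w))%E.
    rewrite integral_mkcond; apply: eq_integral => r _.
    by rewrite /f patchE indicE; case: ifPn; rewrite ?mulr1 ?mulr0.
  have f0 z : (0 <= f z)%E by rewrite lee_fin mulr_ge0// sqr_ge0.
  have mG : measurable_fun setT (fun w => \int[leb]_r f (r, w))%E.
    exact: (measurable_fun_fubini_tonelli_G (m1 := leb) f).
  have G0 w : (0 <= \int[leb]_r f (r, w))%E by exact: integral_ge0.
  have iG : mu.-integrable setT (fun w => \int[leb]_r f (r, w))%E.
    apply/integrableP; split => //.
    under eq_integral do rewrite gee0_abs//.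
    under eq_integral do rewrite -fE.
    rewrite (tonelli_flow flowT _ _ _ vF2)//; first last.
    - by move=> z; exact: sqr_ge0.
    - by move=> w; exact: sqr_ge0.
    - exact: measurable_funX.
    - by rewrite ge0_cp ?ler0n.
    rewrite lte_mul_pinfty//.
    move/integrableP : ih2 => [_]; apply: le_lt_trans; apply: ge0_le_integral => //.
      + by move=> w _; rewrite lee_fin sqr_ge0.
      + by apply/measurable_EFinP; exact: measurable_funX.
      + by apply: measurableT_comp => //; apply/measurable_EFinP; exact: measurable_funX.
      + by move=> w _; rewrite lee_fin ler_norm.
  have := integrable_ae measurableT iG.
  apply: filterS => w /(_ I); rewrite fE.
  by rewrite ge0_fin_numE.
have {}fin : {ae mu, forall w, forall n : nat,
    (\int[leb]_(r in `[(- n%:R)%R, n%:R%R]) (F (r, w) ^+ 2)%:E < +oo)%E}.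
  exact: ae_foralln.
have := version_orbit vF; apply: filterS2 fin => w fin hF.
have mFw := version_slice_measurable vF w.
have mFw2 := version_slice_measurable vF2 w.
have i2 a b : leb.-integrable `[a, b] (fun r => (F (r, w) ^+ 2)%:E).
  have [n [ka kb]] : exists n : nat, - n%:R <= a /\ b <= n%:R.
    exists (Num.truncn (Num.max (- a) b)).+1.
    have := ltW (truncnS_gt (Num.max (- a) b)); rewrite ge_max => /andP[].
    by rewrite lerNl.
  apply: (@integrableS _ _ _ leb `[(- n%:R)%R, n%:R%R]%classic) => //.
    by apply: subset_itvScc; rewrite bnd_simp.
  apply/integrableP; split.
    by apply/measurable_EFinP; exact: measurable_funS mFw2.
  apply: le_lt_trans (fin n); rewrite le_eqVlt; apply/orP; left; apply/eqP.
  by apply: eq_integral => r _; rewrite gee0_abs// lee_fin sqr_ge0.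
split => // a b.
have i1 : leb.-integrable `[a, b] (cst 1%E : R -> \bar R).
  rewrite (_ : cst _ = EFin \o (fun=> 1))//.
  apply: measurable_bounded_integrable => //=.
    by rewrite lebesgue_measure_itv/=; case: ifPn => // _; rewrite -EFinB ltry.
  exact: bounded_cst.
apply: (le_integrable _ _ _ (integrableD _ i1 (i2 a b))) => //.
  by apply/measurable_EFinP; exact: measurable_funS mFw.
move=> r _ /=; rewrite lee_fin [leRHS]ger0_norm ?addr_ge0 ?sqr_ge0//.
have := sqr_ge0 (`|F (r, w)| - 1); rewrite -(real_normK (num_real (F (r, w)))).
have := normr_ge0 (F (r, w)); nra.
Qed.

End orbit_versions.

Section orbit_averages.
Context d (Omega : measurableType d) (R : realType).
Context (mu : probability Omega R) (T : R -> Omega -> Omega).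
Hypothesis mu_complete : measure_is_complete mu.
Hypothesis flowT : measure_flow mu T.
Notation leb := (@lebesgue_measure R).
Implicit Types (h k : Omega -> R) (F : measurableTypeR R * Omega -> R).
Notation version := (version mu T).
Notation orb h w := (fun r : R => h (T r w)).


Lemma orbit_loc_int h : L2R mu h -> {ae mu, forall w,
  loc_int (orb h w) /\ loc_int (fun r => h (T r w) ^+ 2)}.
Proof.
move=> Lh; have [mh _] := Lh.
have [F vF] := version_exists flowT mh.
have := version_L2 flowT Lh vF.
apply: filterS => w [hF i1 i2].
have mF := version_slice_measurable vF w.
split; first by exists (fun r => F (r, w)).
exists (fun r => F (r, w) ^+ 2); split => //.
- exact: measurable_funX.
- by apply: leb_ae_imp hF => r ->.
Qed.

(** The integral of a Borel version is measurable, by Tonelli's theorem applied to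
its positive and negative parts. Completeness of mu transfers this to lint, which
agrees with it almost everywhere. *)
Lemma measurable_lint h a b : L2R mu h ->
  measurable_fun setT (fun w => lint (orb h w) a b).
Proof.
move=> Lh; have [mh _] := Lh.
have [F vF] := version_exists flowT mh; have [mF _] := vF.
apply: (measurable_complete mu_complete
  (g := fun w => fine (\int[leb]_(r in `[a, b]) (F (r, w))%:E))); last first.
  have := version_L2 flowT Lh vF.
  apply: filterS => w [hF _ _].
  by rewrite (lint_ae (version_slice_measurable vF w) hF).
apply: (measurableT_comp (fine_measurable measurableT)).
pose f (z : measurableTypeR R * Omega) := (F z * \1_`[a, b] z.1)%:E.
have mf : measurable_fun setT f.
  apply/measurable_EFinP; apply: measurable_funM => //.
  by apply: (measurableT_comp (measurable_indic _)) => //; exact: measurable_fst.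
rewrite (_ : (fun w => _) = (fun w => \int[leb]_r f^\+ (r, w) - \int[leb]_r f^\- (r, w))%E).
  apply: emeasurable_funB.
    exact: (measurable_fun_fubini_tonelli_G (m1 := leb) _
              (measurable_funepos mf) (funepos_ge0 f)).
  exact: (measurable_fun_fubini_tonelli_G (m1 := leb) _
              (measurable_funeneg mf) (funeneg_ge0 f)).
apply/funext => w; rewrite integral_mkcond integralE; congr (_ - _)%E.
- apply: eq_integral => r _; rewrite !funeposE /f /= patchE indicE.
  by case: ifPn; rewrite ?mulr1 ?mulr0.
- apply: eq_integral => r _; rewrite !funenegE /f /= patchE indicE.
  by case: ifPn; rewrite ?mulr1 ?mulr0.
Qed.

(** Jensen's inequality in time and Tonelli's theorem: averaging over an orbit
    segment is a contraction of L2. *)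
Lemma lint_contraction h a b : a < b -> L2R mu h ->
  (\int[mu]_w (lint (orb h w) a b ^+ 2)%:E <=
   ((b - a) ^+ 2)%:E * \int[mu]_w (h w ^+ 2)%:E)%E.
Proof.
move=> ab Lh; have [mh _] := Lh.
have [F vF] := version_exists flowT mh; have [mF _] := vF.
have mF2 : measurable_fun setT (fun z => F z ^+ 2) by exact: measurable_funX.
have vF2 : version (fun w => h w ^+ 2) (fun z => F z ^+ 2).
  exact: (version_map (phi := fun x => x ^+ 2) _ vF).
have ba0 : 0 <= b - a by rewrite subr_ge0 ltW.
have tF := tonelli_flow flowT (ltW ab) (measurable_funX 2 mh)
  (fun w => sqr_ge0 (h w)) vF2 (fun z => sqr_ge0 (F z)).
pose f (z : measurableTypeR R * Omega) := (F z ^+ 2 * \1_`[a, b] z.1)%:E.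
have mf : measurable_fun setT f.
  apply/measurable_EFinP; apply: measurable_funM => //.
  by apply: (measurableT_comp (measurable_indic _)) => //; exact: measurable_fst.
have fE w : (\int[leb]_(r in `[a, b]) (F (r, w) ^+ 2)%:E = \int[leb]_r f (r, w))%E.
  rewrite integral_mkcond; apply: eq_integral => r _.
  by rewrite /f patchE indicE; case: ifPn; rewrite ?mulr1 ?mulr0.
have f0 z : (0 <= f z)%E by rewrite lee_fin mulr_ge0// sqr_ge0.
have mG : measurable_fun setT (fun w => \int[leb]_(r in `[a, b]) (F (r, w) ^+ 2)%:E)%E.
  rewrite (_ : (fun w => _) = (fun w => \int[leb]_r f (r, w))%E); last exact/funext.
  exact: (measurable_fun_fubini_tonelli_G (m1 := leb) f).
have G0 w : (0 <= \int[leb]_(r in `[a, b]) (F (r, w) ^+ 2)%:E)%E.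
  by rewrite fE; exact: integral_ge0.
apply: (@le_trans _ _ (\int[mu]_w
   ((b - a)%:E * \int[leb]_(r in `[a, b]) (F (r, w) ^+ 2)%:E))%E); last first.
  rewrite ge0_integralZl//.
  by rewrite tF muleA -EFinM.
apply: ae_ge0_le_integral => //.
- by move=> w _; rewrite lee_fin sqr_ge0.
- by apply/measurable_EFinP; apply: measurable_funX; exact: measurable_lint.
- by move=> w _; rewrite mule_ge0// lee_fin.
- by apply: emeasurable_funM.
- have := version_L2 flowT Lh vF.
  apply: filterS2 (orbit_loc_int Lh) => w [l1 l2] [hF _ i2] _.
  have -> : (\int[leb]_(r in `[a, b]) (F (r, w) ^+ 2)%:E)%E =
      (lint (fun r => h (T r w) ^+ 2) a b)%:E.
    rewrite (@lint_ae _ _ (fun r => F (r, w) ^+ 2)).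
    + rewrite /Rintegral fineK//; apply: integrable_fin_num => //; exact: i2.
    + exact: (version_slice_measurable vF2 w).
    + by apply: leb_ae_imp hF => r ->.
  by rewrite -EFinM lee_fin; exact: lint_sqr.
Qed.

Lemma L2R_lint h a b : a < b -> L2R mu h -> L2R mu (fun w => lint (orb h w) a b).
Proof.
move=> ab Lh; have mA := measurable_lint a b Lh; split => //.
have mA2 : measurable_fun setT (fun w => (lint (orb h w) a b ^+ 2)%:E).
  by apply/measurable_EFinP; exact: measurable_funX.
apply/integrableP; split => //.
under eq_integral do rewrite gee0_abs ?lee_fin ?sqr_ge0//.
apply: le_lt_trans (lint_contraction ab Lh) _.
rewrite lte_mul_pinfty ?lee_fin ?sqr_ge0//.
case: Lh => _ /integrableP[_]; apply: le_lt_trans.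
under [leRHS]eq_integral do rewrite gee0_abs ?lee_fin ?sqr_ge0//.
done.
Qed.

(** Fubini's theorem: at each time r, invariance of mu under T r and of k under the
flow turn the pairing of h \o T r with k into that of h with k. *)
Lemma lint_pairing h k a b : a <= b -> L2R mu h -> L2R mu k ->
  (forall r, {ae mu, forall w, k (T r w) = k w}) ->
  (\int[mu]_w (lint (orb h w) a b * k w)%:E =
   (b - a)%:E * \int[mu]_w (h w * k w)%:E)%E.
Proof.
move=> ab Lh Lk kT; have [mh _] := Lh; have [mk ik2] := Lk.
have [F vF] := version_exists flowT mh; have [mF _] := vF.
pose f (z : measurableTypeR R * Omega) := (F z * k z.2 * \1_`[a, b] z.1)%:E.
have mf : measurable_fun setT f.
  apply/measurable_EFinP; apply: measurable_funM; last first.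
    by apply: (measurableT_comp (measurable_indic _)) => //; exact: measurable_fst.
  apply: measurable_funM => //.
  by apply: measurableT_comp => //; exact: measurable_snd.
have m1 : measurable_fun setT (fun z : measurableTypeR R * Omega => (\1_`[a, b] z.1 : R)).
  by apply: (measurableT_comp (measurable_indic _)) => //; exact: measurable_fst.
have indE (G : R -> R) : (\int[leb]_(r in `[a, b]) (G r)%:E =
    \int[leb]_r (G r * \1_`[a, b] r)%:E)%E.
  rewrite integral_mkcond; apply: eq_integral => r _.
  by rewrite patchE indicE; case: ifPn; rewrite ?mulr1 ?mulr0.
have lebab : leb `[a, b] = (b - a)%:E.
  rewrite lebesgue_measure_itv/= lte_fin.
  by move: ab; rewrite le_eqVlt => /predU1P[->|->//]; rewrite ltxx subrr.
have sqfin g : L2R mu g -> (\int[mu]_w (g w ^+ 2)%:E < +oo)%E.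
  move=> [_ /integrableP[_]]; apply: le_lt_trans.
  rewrite le_eqVlt; apply/orP; left; apply/eqP; apply: eq_integral => w _.
  by rewrite gee0_abs// lee_fin sqr_ge0.
have if1 : (leb \x mu)%E.-integrable setT (fun z => (F z ^+ 2 * \1_`[a, b] z.1)%:E).
  apply/integrable21ltyP.
    by apply/measurable_EFinP; apply: measurable_funM => //; exact: measurable_funX.
  have E w : (\int[leb]_r `|(F (r, w) ^+ 2 * \1_`[a, b] r)%:E| =
      \int[leb]_(r in `[a, b]) (F (r, w) ^+ 2)%:E)%E.
    rewrite indE; apply: eq_integral => r _.
    by rewrite gee0_abs// lee_fin mulr_ge0// sqr_ge0.
  under eq_integral do rewrite E.
  have vF2 : version (fun w => h w ^+ 2) (fun z => F z ^+ 2).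
    exact: (version_map (phi := fun x => x ^+ 2) _ vF).
  rewrite (tonelli_flow flowT ab (measurable_funX 2 mh)
    (fun w => sqr_ge0 (h w)) vF2 (fun z => sqr_ge0 (F z))).
  by rewrite lte_mul_pinfty ?lee_fin ?subr_ge0//; exact: sqfin.
have if2 : (leb \x mu)%E.-integrable setT
    (fun z : measurableTypeR R * Omega => (k z.2 ^+ 2 * \1_`[a, b] z.1)%:E).
  apply/integrable21ltyP.
    apply/measurable_EFinP; apply: measurable_funM => //.
    apply: measurable_funX; apply: measurableT_comp => //; exact: measurable_snd.
  have E w : (\int[leb]_r `|(k w ^+ 2 * \1_`[a, b] r)%:E| =
      (b - a)%:E * (k w ^+ 2)%:E)%E.
    transitivity (\int[leb]_(r in `[a, b]) cst (k w ^+ 2)%:E r)%E.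
      rewrite (indE (fun=> k w ^+ 2)); apply: eq_integral => r _.
      by rewrite gee0_abs// lee_fin mulr_ge0// sqr_ge0.
    rewrite integral_cst// muleC; congr (_ * _)%E; exact: lebab.
  under eq_integral do rewrite E.
  rewrite ge0_integralZl//.
  - by rewrite lte_mul_pinfty ?lee_fin ?subr_ge0//; exact: sqfin.
  - by apply/measurable_EFinP; exact: measurable_funX.
  - by move=> w _; rewrite lee_fin sqr_ge0.
  - by rewrite lee_fin subr_ge0.
have if0 : (leb \x mu)%E.-integrable setT f.
  apply: (le_integrable measurableT mf _ (integrableD measurableT if1 if2)).
  move=> z _ /=; rewrite lee_fin -mulrDl !normrM.
  rewrite ler_wpM2r//.
  rewrite [leRHS]ger0_norm ?addr_ge0 ?sqr_ge0//.
  rewrite -(real_normK (num_real (F z))) -(real_normK (num_real (k z.2))).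
  have := sqr_ge0 (`|F z| - `|k z.2|); have := sqr_ge0 (`|F z|); have := sqr_ge0 (`|k z.2|).
  nra.
have LA := measurable_lint a b Lh.
transitivity (\int[mu]_w \int[leb]_r f (r, w))%E.
  apply: ae_eq_integral => //.
  - by apply/measurable_EFinP; exact: measurable_funM.
  - exact: (measurable_fubini_G if0).
  - have := version_L2 flowT Lh vF.
    apply: filterS => w [hF i1 _] _.
    have mFw := version_slice_measurable vF w.
    rewrite (lint_ae mFw hF) EFinM /Rintegral fineK; last first.
      by apply: integrable_fin_num => //; exact: i1.
    rewrite -integralZr//.
    exact: (indE (fun r => F (r, w) * k w)).
rewrite -(@Fubini _ _ _ _ _ leb mu f)//.
have hk : mu.-integrable setT (fun w => (h w * k w)%:E) by exact: L2R_mul.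
transitivity (\int[leb]_(r in `[a, b]) cst (\int[mu]_w (h w * k w)%:E) r)%E.
  rewrite [RHS]integral_mkcond; apply: ae_eq_integral => //.
  - exact: (measurable_fubini_F if0).
  - by apply/(measurable_restrictT _ _).1.
  - apply: leb_ae_imp (version_time vF) => r hr _.
    rewrite patchE; case: ifPn => rab; last first.
      by apply: integral0_eq => w _; rewrite /f indicE/= (negbTE rab) mulr0.
    rewrite -(integral_flow flowT r hk).
    apply: ae_eq_integral => //.
    + exact: measurableT_comp.
    + have mT := flow_measurable flowT r.
      by apply/measurable_EFinP; apply: measurable_funM; exact: measurableT_comp.
    + by apply: filterS2 hr (kT r) => w hw kw _; rewrite /f indicE/= rab mulr1 hw kw.
rewrite integral_cst//= muleC; congr (_ * _)%E; exact: lebab.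
Qed.
End orbit_averages.

(** * Averages along periodic orbits *)

Section periodic.
Context (R : realType).
Implicit Types (G : R -> R) (p s t x y M : R).

Lemma periodic_shift G p (n : nat) : (forall x, G (x + p) = G x) ->
  forall x, G (x + n%:R * p) = G x.
Proof.
move=> Gp; elim: n => [|n IH] x; first by rewrite mul0r addr0.
by rewrite -natr1 mulrDl mul1r addrA Gp IH.
Qed.

Lemma lint_period G p x y : loc_int G -> (forall x, G (x + p) = G x) ->
  0 < p -> lint G x (x + p) = lint G y (y + p).
Proof.
move=> lG Gp p0; have px z : z <= z + p by rewrite lerDl ltW.
wlog xy : x y / x <= y => [H|].
  by have [xy|/ltW yx] := leP x y; [exact: H|apply/esym/H].
have := lint_cat lG xy (px y); have xyp : x + p <= y + p by rewrite lerD2r.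
rewrite -(lint_cat lG (px x) xyp) -(lint_shift p x y lG).
rewrite (_ : (fun x => G (x + p)) = G); last exact/funext.
lra.
Qed.

Lemma lint_periods G p x (n : nat) : loc_int G -> (forall x, G (x + p) = G x) ->
  0 < p -> lint G x (x + n%:R * p) = n%:R * lint G 0 p.
Proof.
move=> lG Gp p0; elim: n => [|n IH].
  by rewrite !mul0r addr0; have := lint_cat lG (lexx x) (lexx x); lra.
have np : x <= x + n%:R * p by rewrite lerDl mulr_ge0// ltW.
rewrite -natr1 !mulrDl !mul1r -IH addrA -(lint_cat lG np) ?lerDl ?ltW//.
by rewrite (lint_period _ 0 lG Gp p0) add0r.
Qed.

(** Cut [s, t] into whole periods and a remainder shorter than one period. *)
Lemma lint_periodic_mean G p s t M : loc_int G -> (forall x, G (x + p) = G x) ->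
  0 < p -> p <= M -> s < t ->
  `|lint G s t - (t - s) * (lint G 0 p / p)| <=
    2 * lint (fun x => `|G x|) s (s + M).
Proof.
move=> lG Gp p0 pM st; set c := lint G 0 p / p.
set n := Num.truncn ((t - s) / p).
have ts0 : 0 <= (t - s) / p by rewrite divr_ge0 ?subr_ge0 ?ltW.
have /andP[nt tn] : n%:R * p <= t - s < n%:R * p + p.
  have /andP[] := truncn_itv ts0.
  by rewrite -/n ler_pdivlMr// ltr_pdivrMr// -natr1 mulrDl mul1r => -> ->.
have lN := loc_int_norm lG.
have bound x : s <= x -> x <= s + M ->
    `|lint G s x| <= lint (fun x => `|G x|) s (s + M).
  move=> sx xM; apply: le_trans (lint_norm _ _ lG) _.
  by apply: lint_widen.
have cp : lint G 0 p = c * p by rewrite /c divfK// gt_eqF.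
have b1 := bound (t - n%:R * p) ltac:(lra) ltac:(lra).
have b2 := bound (s + p) ltac:(lra) ltac:(lra).
move: b2; rewrite (lint_period s 0 lG Gp p0) add0r cp => b2.
have -> : lint G s t = n%:R * (c * p) + lint G s (t - n%:R * p).
  have np : s <= s + n%:R * p by rewrite lerDl mulr_ge0// ltW.
  rewrite -(lint_cat lG np) ?lint_periods// ?cp; last lra.
  congr (_ + _).
  have E : (fun x => G (x + n%:R * p)) = G by apply/funext; exact: periodic_shift.
  by rewrite -{2}E lint_shift// subrK.
have b3 : `|(t - s - n%:R * p) * c| <= `|c * p|.
  rewrite [_ * c]mulrC !normrM; apply: ler_wpM2l => //.
  rewrite !ger0_norm; lra.
rewrite (_ : _ - _ = lint G s (t - n%:R * p) - (t - s - n%:R * p) * c); last by ring.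
apply: le_trans (ler_normB _ _) _; lra.
Qed.
End periodic.

Section bounded_period.
Context d (Omega : measurableType d) (R : realType).
Context (mu : probability Omega R) (T : R -> Omega -> Omega).
Hypothesis mu_complete : measure_is_complete mu.
Hypothesis flowT : measure_flow mu T.
Notation leb := (@lebesgue_measure R).
Implicit Types (h k : Omega -> R) (F : measurableTypeR R * Omega -> R).
Notation version := (version mu T).
Notation orb h w := (fun r : R => h (T r w)).


Variable M : R.
Hypothesis M0 : 0 < M.
Hypothesis periodic_ae :
  {ae mu, forall w, exists p, [/\ 0 < p, p <= M & T p w = w]}.

(** The limit superior makes this a measurable function of w without any assumption
on the existence of the limit, which holds at almost every point. *)
Definition time_limit h w : R :=
  fine (limn_esup (fun n => (lint (orb h w) 0 n.+1%:R / n.+1%:R)%:E)).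

Lemma limn_esup_cvg (u : R^nat) (c : R) : u @ \oo --> c ->
  limn_esup (EFin \o u) = c%:E.
Proof.
move=> uc; have : EFin \o u @ \oo --> c%:E.
  by apply: cvg_EFin => //; exact: nearW.
by move=> /cvg_limn_einf_sup[].
Qed.

(** Here p is any period, not necessarily the least one. By [lint_periodic_mean] the
average over [0, n.+1] is within O(1 / n) of the mean over one period. *)
Lemma time_limit_period h w p : loc_int (orb h w) -> 0 < p -> T p w = w ->
  time_limit h w = lint (orb h w) 0 p / p.
Proof.
move=> l1 p0 Tp; rewrite /time_limit.
set c := _ / p.
suff uc : (fun n => lint (orb h w) 0 n.+1%:R / n.+1%:R) @ \oo --> c.
  by have := limn_esup_cvg uc; rewrite /comp => ->.
have Gp x : (orb h w) (x + p) = orb h w x by rewrite (flowD flowT) Tp.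
set K := 2 * lint (fun x => `|orb h w x|) 0 (0 + p).
have K0 : 0 <= K by rewrite mulr_ge0// lint_ge0.
apply: (@squeeze_cvgr _ _ _ _ (fun n => c - K / n.+1%:R) (fun n => c + K / n.+1%:R)).
- apply: nearW => n; rewrite -ler_distl.
  have n0 : 0 < n.+1%:R :> R by rewrite ltr0n.
  have := lint_periodic_mean l1 Gp p0 (lexx p) n0.
  rewrite subr0 -/c -/K => H; rewrite ler_pdivlMr//.
  rewrite -[X in _ * X <= _](gtr0_norm n0) -normrM.
  by rewrite mulrBl divfK ?gt_eqF// [c * _]mulrC.
- rewrite -[X in _ --> X](subr0 c); apply: cvgB; first exact: cvg_cst.
  rewrite -[X in _ --> X](mulr0 K); apply: cvgM; first exact: cvg_cst.
  exact: cvg_harmonic.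
- rewrite -[X in _ --> X](addr0 c); apply: cvgD; first exact: cvg_cst.
  rewrite -[X in _ --> X](mulr0 K); apply: cvgM; first exact: cvg_cst.
  exact: cvg_harmonic.
Qed.

Lemma time_limit_measurable h : L2R mu h -> measurable_fun setT (time_limit h).
Proof.
move=> Lh; apply: (measurableT_comp (fine_measurable measurableT)).
apply: measurable_fun_limn_esup => n; apply/measurable_EFinP.
exact: (measurable_funM (measurable_lint mu_complete flowT _ _ Lh)).
Qed.

Lemma time_limit_dist h : L2R mu h -> {ae mu, forall w, forall s t, s < t ->
  `|lint (orb h w) s t / (t - s) - time_limit h w| <=
    2 / (t - s) * lint (fun r => `|h (T r w)|) s (s + M)}.
Proof.
move=> Lh; apply: filterS2 (orbit_loc_int flowT Lh) periodic_ae.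
move=> w [l1 _] [p [p0 pM Tp]] s t st.
have Gp x : (orb h w) (x + p) = orb h w x by rewrite (flowD flowT) Tp.
rewrite (time_limit_period l1 p0 Tp).
have ts0 : 0 < t - s by rewrite subr_gt0.
have := lint_periodic_mean l1 Gp p0 pM st.
set c := _ / p; set K := lint _ _ _ => H.
rewrite mulrAC ler_pdivlMr// -[X in _ * X <= _](gtr0_norm ts0) -normrM.
by rewrite mulrBl divfK ?gt_eqF// [c * _]mulrC.
Qed.

(** Integrate over the space the square of the pointwise bound; the orbit integral of
|h| over a window of length M has norm at most M times the norm of h. *)
Lemma time_limit_L2_dist h s t : L2R mu h -> s < t ->
  (\int[mu]_w ((lint (orb h w) s t / (t - s) - time_limit h w) ^+ 2)%:E <=
   ((2 * M / (t - s)) ^+ 2)%:E * \int[mu]_w (h w ^+ 2)%:E)%E /\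
  L2R mu (fun w => lint (orb h w) s t / (t - s) - time_limit h w).
Proof.
move=> Lh st; have ts0 : 0 < t - s by rewrite subr_gt0.
have LN := L2R_norm Lh.
have sM : s < s + M by rewrite ltrDl.
have LA := L2RZ (2 / (t - s)) (L2R_lint mu_complete flowT sM LN).
have mD : measurable_fun setT
    (fun w => lint (orb h w) s t / (t - s) - time_limit h w).
  apply: measurable_funB; last exact: time_limit_measurable.
  exact: (measurable_funM (measurable_lint mu_complete flowT _ _ Lh)).
have dist : {ae mu, forall w,
  (lint (orb h w) s t / (t - s) - time_limit h w) ^+ 2 <=
  (2 / (t - s) * lint (fun r => `|h (T r w)|) s (s + M)) ^+ 2}.
  apply: filterS (time_limit_dist Lh) => w /(_ s t st) H.
  rewrite -real_normK ?num_real// ler_sqr// ?nnegrE ?(le_trans _ H)//.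
split; last exact: L2R_le dist.
have := lint_contraction mu_complete flowT sM LN.
have -> : s + M - s = M by lra.
under [X in (_ <= _ * X)%E -> _]eq_integral do rewrite real_normK ?num_real//.
move=> H; apply: (@le_trans _ _ (\int[mu]_w
  ((2 / (t - s) * lint (fun r => `|h (T r w)|) s (s + M)) ^+ 2)%:E)%E).
  apply: ae_ge0_le_integral => //.
  - by move=> w _; rewrite lee_fin sqr_ge0.
  - by apply/measurable_EFinP; exact: measurable_funX.
  - by move=> w _; rewrite lee_fin sqr_ge0.
  - by case: LA => mA _; apply/measurable_EFinP; exact: measurable_funX.
  - by apply: filterS dist => w + _; rewrite lee_fin.
under eq_integral do rewrite exprMn EFinM.
rewrite ge0_integralZl//; first last.
- by rewrite lee_fin sqr_ge0.
- by move=> w _; rewrite lee_fin sqr_ge0.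
- apply/measurable_EFinP; apply: measurable_funX; exact: (measurable_lint mu_complete flowT s (s + M) LN).
apply: le_trans (lee_wpmul2l _ H) _; first by rewrite lee_fin sqr_ge0.
rewrite muleA -EFinM -exprMn le_eqVlt; apply/orP; left; apply/eqP.
by congr (_ * _)%E; congr (_ ^+ _)%:E; rewrite mulrAC.
Qed.

Lemma time_limit_L2 h : L2R mu h -> L2R mu (time_limit h).
Proof.
move=> Lh; have [_ LD] := time_limit_L2_dist Lh (@ltr01 R).
have LA := L2R_lint mu_complete flowT (@ltr01 R) Lh.
rewrite (_ : time_limit h = fun w => lint (orb h w) 0 1 -
   (lint (orb h w) 0 1 / (1 - 0) - time_limit h w)); first exact: L2RB.
by apply/funext => w; rewrite subr0 divr1; lra.
Qed.

Lemma time_limit_fixed h r : L2R mu h ->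
  {ae mu, forall w, time_limit h (T r w) = time_limit h w}.
Proof.
move=> Lh; apply: filterS2 (orbit_loc_int flowT Lh) periodic_ae.
move=> w [l1 _] [p [p0 pM Tp]].
have Gp x : (orb h w) (x + p) = orb h w x by rewrite (flowD flowT) Tp.
have E : orb h (T r w) = (fun x => orb h w (x + r)).
  by apply/funext => x; rewrite (flowD flowT).
rewrite (time_limit_period l1 p0 Tp) (@time_limit_period h (T r w) p)//.
- by rewrite E (lint_shift r 0 p l1) add0r addrC (lint_period r 0 l1 Gp p0) add0r.
- by rewrite E; exact: (loc_int_shift r l1).
- by rewrite -(flowD flowT) addrC (flowD flowT) Tp.
Qed.

(** The averages of h pair with k as h does ([lint_pairing]) and converge in L2 to
the time limit. *)
Lemma time_limit_pairing h k : L2R mu h -> L2R mu k ->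
  (forall r, {ae mu, forall w, k (T r w) = k w}) ->
  (\int[mu]_w ((h w - time_limit h w) * k w)%:E = 0)%E.
Proof.
move=> Lh Lk kT.
have LE := time_limit_L2 Lh.
have ihk := L2R_mul (L2RB Lh LE) Lk.
have sqfin g : L2R mu g -> exists x : R, (\int[mu]_w (g w ^+ 2)%:E = x%:E)%E.
  by move=> [_ /(integrable_fin_num measurableT)/fineK <-]; eexists.
have [a ha] := sqfin _ Lh; have [b kb] := sqfin _ Lk.
have [x hx] : exists x : R, (\int[mu]_w ((h w - time_limit h w) * k w)%:E = x%:E)%E.
  by have /(integrable_fin_num measurableT)/fineK <- := ihk; eexists.
rewrite hx; congr EFin.
have bound (n : nat) : `|x| <= (4 * M ^+ 2 * a + b) / n.+1%:R.
  have n0 : 0 < n.+1%:R :> R by rewrite ltr0n.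
  have [H LD] := time_limit_L2_dist Lh n0; rewrite subr0 in H LD.
  have LA := L2R_lint mu_complete flowT n0 Lh.
  set D := (fun w => _ - _) in LD.
  have [y Dy] := sqfin _ LD.
  have iDk := L2R_mul LD Lk.
  have xE : (x%:E = \int[mu]_w (D w * k w)%:E)%E.
    rewrite -hx; apply/esym.
    have i3 : mu.-integrable setT (fun w => (n.+1%:R^-1 * lint (orb h w) 0 n.+1%:R * k w)%:E).
      by apply: L2R_mul => //; exact: L2RZ.
    have i4 : mu.-integrable setT (fun w => (h w * k w)%:E) by exact: L2R_mul.
    have i5 : mu.-integrable setT (fun w => (time_limit h w * k w)%:E) by exact: L2R_mul.
    transitivity (\int[mu]_w (n.+1%:R^-1 * lint (orb h w) 0 n.+1%:R * k w)%:E - \int[mu]_w (time_limit h w * k w)%:E)%E.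
      rewrite -integralB//; apply: eq_integral => w _.
      by rewrite -EFinB; congr EFin; rewrite /D; ring.
    transitivity (\int[mu]_w (h w * k w)%:E - \int[mu]_w (time_limit h w * k w)%:E)%E.
      congr (_ - _)%E.
      under eq_integral do rewrite -mulrA EFinM.
      rewrite integralZl//; last first.
        by apply: L2R_mul => //.
      rewrite (lint_pairing mu_complete flowT (ltW n0))// muleA -EFinM subr0.
      by rewrite mulVf ?gt_eqF// mul1e.
    rewrite -integralB//; apply: eq_integral => w _.
    by rewrite -EFinB; congr EFin; ring.
  (* D has squared norm O(1 / n ^ 2): with the weights n and 1 / n both terms of
     this bound of the product of D and k have integrals of order 1 / n. *)
  have : (`|x%:E| <= \int[mu]_w (n.+1%:R * (D w) ^+ 2 + n.+1%:R^-1 * k w ^+ 2)%:E)%E.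
    rewrite xE; apply: le_trans (le_abse_integral _ _ _) _ => //.
      by apply: (measurable_int mu).
    have i1 : mu.-integrable setT (fun w => (n.+1%:R)%:E * (D w ^+ 2)%:E)%E.
      by apply: integrableZl => //; case: LD.
    have i2 : mu.-integrable setT (fun w => (n.+1%:R^-1)%:E * (k w ^+ 2)%:E)%E.
      by apply: integrableZl => //; case: Lk.
    apply: ge0_le_integral => //.
    - by apply: measurableT_comp => //; exact: (measurable_int mu).
    - exact: (measurable_int mu (integrableD measurableT i1 i2)).
    - move=> w _; rewrite lee_fin normrM.
      rewrite -(real_normK (num_real (D w))) -(real_normK (num_real (k w))).
      set d1 := `|D w|; set k1 := `|k w|.
      have d10 : 0 <= d1 by exact: normr_ge0.
      have k10 : 0 <= k1 by exact: normr_ge0.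
      have := sqr_ge0 (n.+1%:R * d1 - k1).
      have := mulr_ge0 (ltW n0) (mulr_ge0 d10 k10).
      rewrite -(ler_pM2l n0) (_ : n.+1%:R * (_ + _) = n.+1%:R ^+ 2 * d1 ^+ 2 + k1 ^+ 2).
        by nra.
      by field; rewrite gt_eqF.
  have -> : (\int[mu]_w (n.+1%:R * (D w) ^+ 2 + n.+1%:R^-1 * k w ^+ 2)%:E =
     (n.+1%:R * y + n.+1%:R^-1 * b)%:E)%E.
    rewrite EFinD !EFinM -Dy -kb.
    have i1 : mu.-integrable setT (fun w => (D w ^+ 2)%:E) by case: LD.
    have i2 : mu.-integrable setT (fun w => (k w ^+ 2)%:E) by case: Lk.
    by rewrite -!integralZl// -integralD//; exact: integrableZl.
  rewrite lee_fin => /le_trans; apply.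
  move: H; rewrite Dy ha -EFinM lee_fin => H.
  rewrite mulrDl [n.+1%:R^-1 * b]mulrC lerD2r.
  apply: le_trans (ler_wpM2l (ltW n0) H) _.
  rewrite le_eqVlt; apply/orP; left; apply/eqP; field.
  by rewrite gt_eqF.
apply/eqP; rewrite -normr_le0.
have : (fun n => (4 * M ^+ 2 * a + b) / n.+1%:R) @ \oo --> (0 : R).
  rewrite -[X in _ --> X](mulr0 (4 * M ^+ 2 * a + b)); apply: cvgM; first exact: cvg_cst.
  exact: cvg_harmonic.
move=> /cvg_lim <-//; apply: limr_ge.
  apply/cvg_ex; exists 0; rewrite -[X in _ --> X](mulr0 (4 * M ^+ 2 * a + b)); apply: cvgM; first exact: cvg_cst.
  exact: cvg_harmonic.
exact: nearW.
Qed.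
End bounded_period.

(** * A spectral gap and slowly returning sets *)

(** Two windows are shifted: x0, y0 are the times spent in them before the shift
and x1, y1 after it; c1, c2 are lost at the beginning and e1, e2 gained at the
end. *)
Lemma norm_window_shift (R : realDomainType) (x0 x1 y0 y1 c1 e1 c2 e2 w1 w2 w3 w4 : R) :
  x0 + e1 = c1 + x1 -> y0 + e2 = c2 + y1 ->
  0 <= c1 -> 0 <= e1 -> 0 <= c2 -> 0 <= e2 ->
  c1 <= w1 -> e1 <= w2 -> c2 <= w3 -> e2 <= w4 ->
  `|x1 - y1 - (x0 - y0)| <= w1 + w2 + (w3 + w4).
Proof. by move=> *; rewrite ler_norml; apply/andP; split; lra. Qed.

Lemma pairwise_le16 (R : realDomainType) (a b c : R) :
  a <= 2 * (c + c) -> b <= 2 * (c + c) -> 2 * (a + b) <= 16 * c.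
Proof. lra. Qed.

Section nrm2.
Context d (X : measurableType d) (R : realType).
Context (mu : {measure set X -> \bar R}).
Implicit Types f g : X -> R.

Definition nrm2 f : R := \int[mu]_x (f x ^+ 2).

Lemma nrm2E f : L2R mu f -> (\int[mu]_x (f x ^+ 2)%:E = (nrm2 f)%:E)%E.
Proof.
by move=> [_ i2]; rewrite /nrm2 /Rintegral fineK//; exact: integrable_fin_num.
Qed.

Lemma nrm2_ge0 f : 0 <= nrm2 f.
Proof. by apply: Rintegral_ge0 => x _; exact: sqr_ge0. Qed.

Lemma nrm2_le f g : L2R mu f -> L2R mu g ->
  {ae mu, forall x, f x ^+ 2 <= g x ^+ 2} -> nrm2 f <= nrm2 g.
Proof.
move=> Lf Lg fg; rewrite -lee_fin -!nrm2E//.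
case: (Lf) (Lg) => _ i1 [_ i2].
apply: ae_ge0_le_integral => //.
- by move=> w _; rewrite lee_fin sqr_ge0.
- exact: (measurable_int mu).
- by move=> w _; rewrite lee_fin sqr_ge0.
- exact: (measurable_int mu).
- by apply: filterS fg => x + _; rewrite lee_fin.
Qed.

Lemma nrm2_eq f g : L2R mu f -> L2R mu g ->
  {ae mu, forall x, f x = g x} -> nrm2 f = nrm2 g.
Proof.
move=> Lf Lg fg; apply/eqP; rewrite eq_le; apply/andP; split;
  by apply: nrm2_le => //; apply: filterS fg => x ->.
Qed.

Lemma nrm2Z c f : L2R mu f -> nrm2 (fun x => c * f x) = c ^+ 2 * nrm2 f.
Proof.
move=> [_ i2]; rewrite /nrm2 -RintegralZl//.
by apply: eq_Rintegral => x _; rewrite exprMn.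
Qed.

Lemma nrm2D_le f g : L2R mu f -> L2R mu g ->
  nrm2 (fun x => f x + g x) <= 2 * (nrm2 f + nrm2 g).
Proof.
move=> Lf Lg; have [[_ i1] [_ i2]] := (Lf, Lg).
rewrite /nrm2 -RintegralD// -RintegralZl//; last first.
  exact: (integrableD measurableT i1 i2).
apply: le_Rintegral => //.
- by have [] := L2RD Lf Lg.
- by apply: (integrableZl measurableT 2 (integrableD measurableT i1 i2)).
- by move=> x _; have := sqr_ge0 (f x - g x); nra.
Qed.

Lemma nrm2D_ge f g : L2R mu f -> L2R mu g ->
  {ae mu, forall x, 0 <= f x * g x} ->
  nrm2 f + nrm2 g <= nrm2 (fun x => f x + g x).
Proof.
move=> Lf Lg fg; have [[_ i1] [_ i2]] := (Lf, Lg).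
have [mD iD] := L2RD Lf Lg.
rewrite -lee_fin EFinD -!nrm2E// -?ge0_integralD//.
- apply: ae_ge0_le_integral => //.
  + by move=> x _; rewrite -EFinD lee_fin addr_ge0 ?sqr_ge0.
  + by apply: emeasurable_funD; exact: (measurable_int mu).
  + by move=> w _; rewrite lee_fin sqr_ge0.
  + exact: (measurable_int mu).
  + by apply: filterS fg => x fg _; rewrite -EFinD lee_fin; nra.
- by move=> w _; rewrite lee_fin sqr_ge0.
- exact: (measurable_int mu).
- by move=> w _; rewrite lee_fin sqr_ge0.
- exact: (measurable_int mu).
Qed.

Lemma nrm2_eq0 f : L2R mu f -> nrm2 f = 0 -> {ae mu, forall x, f x = 0}.
Proof.
move=> Lf f0; have : {ae mu, forall x, (f x ^+ 2)%:E = 0%E}.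
  apply: ge0_integral0_ae.
  - by have [_ i2] := Lf; exact: (measurable_int mu).
  - by move=> x; rewrite lee_fin sqr_ge0.
  - by rewrite nrm2E// f0.
by apply: filterS => x [/eqP]; rewrite sqrf_eq0 => /eqP.
Qed.
End nrm2.

Section tower.
Context d (Omega : measurableType d) (R : realType).
Context (mu : probability Omega R) (T : R -> Omega -> Omega).
Hypothesis mu_complete : measure_is_complete mu.
Hypothesis flowT : measure_flow mu T.
Notation leb := (@lebesgue_measure R).
Implicit Types (h k : Omega -> R) (F : measurableTypeR R * Omega -> R).
Notation version := (version mu T).
Notation orb h w := (fun r : R => h (T r w)).


Lemma L2R_flow h r : L2R mu h -> L2R mu (fun w => h (T r w)).
Proof.
move=> [mh i2]; have mT := flow_measurable flowT r.
have mhT : measurable_fun setT (fun w => h (T r w)) by exact: measurableT_comp.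
split => //; apply/integrableP; split.
  by apply/measurable_EFinP; exact: measurable_funX.
have := ge0_integral_flow flowT (h := fun w => `|(h w ^+ 2)%:E|%E) r.
move=> -> //.
- by case/integrableP : i2.
- by apply: measurableT_comp => //; exact: (measurable_int mu).
Qed.

Lemma nrm2_flow h r : L2R mu h -> nrm2 mu (fun w => h (T r w)) = nrm2 mu h.
Proof.
move=> Lh; have [mh i2] := Lh; apply: EFin_inj.
rewrite -!nrm2E//; last exact: L2R_flow.
apply: (ge0_integral_flow flowT (h := fun w => (h w ^+ 2)%:E)).
  exact: (measurable_int mu).
by move=> w; rewrite lee_fin sqr_ge0.
Qed.

Lemma L2R_bounded h K : measurable_fun setT h -> (forall w, `|h w| <= K) -> L2R mu h.
Proof.
move=> mh hK; split => //; apply: measurable_bounded_integrable => //.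
- exact: fin_num_fun_lty.
- exact: measurable_funX.
- exists (K ^+ 2); split; first exact: num_real.
  move=> x Kx w _ /=; rewrite ger0_norm ?sqr_ge0//; apply: le_trans (ltW Kx).
  rewrite -real_normK ?num_real// ler_sqr ?nnegrE//; apply: le_trans (hK w) => //.
Qed.

(* gap says that averaging over [0, l] halves, at least, the norm of a function
   orthogonal to all fixed functions. *)
Variables (l : R) (A : set Omega).
Hypothesis l0 : 0 < l.
Hypothesis mA : measurable A.
Hypothesis gap : forall f, L2R mu f ->
  (forall k, L2R mu k -> (forall r, {ae mu, forall w, k (T r w) = k w}) ->
     (\int[mu]_w (f w * k w)%:E = 0)%E) ->
  4 * nrm2 mu (fun w => lint (orb f w) 0 l / l) <= nrm2 mu f.
Hypothesis sep : forall w s, A w -> l < s -> s < 200 * l -> ~ A (T s w).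

(** The time spent in A by the orbit of w during [x, y]. *)
Let N x y w := lint (orb (\1_A) w) x y.
Let beta := nrm2 mu (N 0 l).

Let LA : L2R mu (\1_A : Omega -> R).
Proof.
apply: (@L2R_bounded _ 1); first exact: measurable_indic.
by move=> w; rewrite indicE; case: (_ \in _); rewrite ?normr1 ?normr0.
Qed.

Let LN x y : x < y -> L2R mu (N x y).
Proof. by move=> xy; exact: (L2R_lint mu_complete flowT xy LA). Qed.

Let nice : {ae mu, forall w, loc_int (orb (\1_A) w)}.
Proof. by apply: filterS (orbit_loc_int flowT LA) => w []. Qed.

Let N_ge0 x y w : 0 <= N x y w.
Proof. by apply: lint_ge0. Qed.

Let N_flow x y r w : loc_int (orb (\1_A) w) -> N x y (T r w) = N (x + r) (y + r) w.
Proof.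
move=> lw; rewrite /N -(lint_shift r x y lw); congr lint.
by apply/funext => z; rewrite (flowD flowT).
Qed.

Let nrm2_N x : nrm2 mu (N x (x + l)) = beta.
Proof.
rewrite /beta -(nrm2_flow x (LN l0)); apply: nrm2_eq.
- by apply: LN; rewrite ltrDl.
- by apply: L2R_flow; exact: LN.
- by apply: filterS nice => w lw; rewrite N_flow// add0r addrC.
Qed.

Let beta_le_nrm2_N x : beta <= nrm2 mu (N x (x + l)).
Proof. by rewrite nrm2_N. Qed.

(** The time spent in A during [0, (n + 1) l] is a sum of n + 1 nonnegative functions
of squared norm beta. *)
Let nrm2_long (n : nat) : n.+1%:R * beta <= nrm2 mu (N 0 (n.+1%:R * l)).
Proof.
elim: n => [|n IH]; first by rewrite !mul1r.
have nl0 : 0 < n.+1%:R * l by rewrite mulr_gt0// ltr0n.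
have L1 := LN nl0.
have L2 : L2R mu (N (n.+1%:R * l) (n.+1%:R * l + l)) by apply: LN; rewrite ltrDl.
rewrite -natr1 mulrDl mul1r mulrDl mul1r.
apply: (@le_trans _ _ (nrm2 mu (fun w => N 0 (n.+1%:R * l) w + N (n.+1%:R * l) (n.+1%:R * l + l) w))).
  have L12 : {ae mu, forall w, 0 <= N 0 (n.+1%:R * l) w * N (n.+1%:R * l) (n.+1%:R * l + l) w}.
    by apply: nearW => w; exact: mulr_ge0.
  apply: le_trans (nrm2D_ge L1 L2 L12).
  apply: (lerD IH); exact: beta_le_nrm2_N.
apply: nrm2_le; [exact: L2RD|by apply: LN; rewrite addr_gt0|].
by apply: filterS nice => w lw; rewrite /N lint_cat// ?lerDl ltW.
Qed.

(* In the final comparison n beta <= 64 beta, so that 65 forces beta = 0. *)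
Let n : R := 65.
Let X w := N 0 (n * l) w.
Let f w := X w - X (T (2 * n * l) w).

Let LX : L2R mu X.
Proof. by apply: LN; rewrite mulr_gt0. Qed.

Let Lf : L2R mu f.
Proof. exact: (L2RB LX (L2R_flow _ LX)). Qed.

Let f_orth k : L2R mu k -> (forall r, {ae mu, forall w, k (T r w) = k w}) ->
  (\int[mu]_w (f w * k w)%:E = 0)%E.
Proof.
move=> Lk kT; have i1 := L2R_mul LX Lk.
have i2 := L2R_mul (L2R_flow (2 * n * l) LX) Lk.
transitivity (\int[mu]_w (X w * k w)%:E - \int[mu]_w (X (T (2 * n * l) w) * k w)%:E)%E.
  by rewrite -integralB//; apply: eq_integral => w _; rewrite -EFinB /f mulrBl.
rewrite -(integral_flow flowT (2 * n * l) i1).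
set I := (X in (X - _)%E); set J := (X in (_ - X)%E).
have -> : I = J.
  apply: ae_eq_integral => //.
  - have mT := flow_measurable flowT (2 * n * l).
    apply: (measurableT_comp (f := fun w => (X w * k w)%:E)) => //.
    exact: (measurable_int mu).
  - exact: (measurable_int mu).
  - by apply: filterS (kT (2 * n * l)) => w -> _.
rewrite subee//; exact: integrable_fin_num.
Qed.

(** Visits to A during [0, n l] and during [2 n l, 3 n l] are separated by a time
between n l = 65 l and 3 n l = 195 l, which lies in ]l, 200 l[. *)
Let X_disjoint w : X w * X (T (2 * n * l) w) = 0.
Proof.
apply/eqP; rewrite mulf_eq0 -implyNb; apply/implyP => X0.
have [r [/andP[r0 rn] Ar]] : exists r : R, 0 <= r <= n * l /\ A (T r w).
  apply: contrapT => nr; move/eqP: X0; apply.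
  rewrite /X /N (@lint_eq _ _ (fun=> 0)) ?lint_cst ?mul0r//.
    by rewrite mulr_ge0// ltW.
  move=> r rn; rewrite indicE memNset// => Ar; apply: nr; by exists r.
apply/eqP.
rewrite /X /N (@lint_eq _ _ (fun=> 0)) ?lint_cst ?mul0r//.
  by rewrite mulr_ge0// ltW.
move=> t /andP[t0 tn]; rewrite indicE memNset// -(flowD flowT) => At.
have := sep (s := t + 2 * n * l - r) Ar.
rewrite -(flowD flowT) subrK; apply => //; rewrite /n in rn tn *; move: l0; lra.
Qed.

Let nrm2_f_ge : n * beta <= nrm2 mu f.
Proof.
apply: (@le_trans _ _ (nrm2 mu X)); first exact: nrm2_long.
apply: nrm2_le => //; apply: nearW => w; have := X_disjoint w; rewrite /f.
have := sqr_ge0 (X (T (2 * n * l) w)); nra.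
Qed.

(** The time spent in A during the l units of time that follow each of the four ends
of the two windows of f: along an orbit segment of length l, f varies by at most
S. *)
Let S w := (N 0 l w + N (n * l) (n * l + l) w) +
  (N (2 * n * l) (2 * n * l + l) w +
   N (2 * n * l + n * l) (2 * n * l + n * l + l) w).

Let S_bound w tau : loc_int (orb (\1_A) w) -> 0 <= tau <= l ->
  `|f (T tau w) - f w| <= S w.
Proof.
move=> lw /andP[t0 tl].
have n0 : 0 <= n * l by rewrite mulr_ge0// ltW.
have n2 : 0 <= 2 * n * l by rewrite !mulr_ge0// ltW.
have E x : N x (x + n * l) w + N (x + n * l) (x + n * l + tau) w =
           N x (x + tau) w + N (x + tau) (x + tau + n * l) w.
  by rewrite /N !lint_cat ?lerDl// addrAC.
have W x : N x (x + tau) w <= N x (x + l) w.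
  apply: lint_widen => //; first by rewrite lerDl.
  by rewrite lerD2l.
rewrite /f -(flowD flowT) /X !N_flow// !add0r.
have E1 := E 0; have E2 := E (2 * n * l); rewrite !add0r in E1.
have W1 := W 0; rewrite !add0r in W1.
rewrite (_ : 2 * n * l + tau + n * l = n * l + (2 * n * l + tau)) in E2; last by ring.
rewrite (_ : tau + n * l = n * l + tau) in E1; last by ring.
rewrite [n * l + 2 * n * l]addrC.
apply: (norm_window_shift E1 E2) => //.
Qed.

Let LS : L2R mu S.
Proof. by apply: L2RD; apply: L2RD; apply: LN; rewrite ?ltrDl. Qed.

Let nrm2_S : nrm2 mu S <= 16 * beta.
Proof.
have L x : L2R mu (N x (x + l)) by apply: LN; rewrite ltrDl.
have L0 : L2R mu (N 0 l) by exact: LN.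
have h1 := nrm2D_le L0 (L (n * l)).
have h2 := nrm2D_le (L (2 * n * l)) (L (2 * n * l + n * l)).
rewrite (nrm2_N (n * l)) in h1.
rewrite (nrm2_N (2 * n * l)) (nrm2_N (2 * n * l + n * l)) in h2.
apply: le_trans (nrm2D_le (L2RD L0 (L (n * l)))
  (L2RD (L (2 * n * l)) (L (2 * n * l + n * l)))) _.
exact: (pairwise_le16 h1 h2).
Qed.

(** The average of f differs from f by at most S, of squared norm at most 16 beta, and
its norm is at most half that of f. Hence the squared norm of f is at most
64 beta, while it is at least 65 beta. *)
Lemma tower_null : mu A = 0%E.
Proof.
have Lavg : L2R mu (fun w => lint (orb f w) 0 l / l).
  rewrite (_ : (fun w => _) = fun w => l^-1 * lint (orb f w) 0 l).
    by apply: L2RZ; exact: L2R_lint.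
  by apply/funext => w; rewrite mulrC.
have LB := L2RB Lf Lavg.
have close : nrm2 mu (fun w => f w - lint (orb f w) 0 l / l) <= nrm2 mu S.
  apply: nrm2_le => //.
  apply: filterS2 nice (orbit_loc_int flowT Lf) => w lw [lf _].
  rewrite -real_normK ?num_real// ler_sqr ?nnegrE//; last first.
    by rewrite !addr_ge0.
  have dE : f w - lint (orb f w) 0 l / l = - lint (fun r => f (T r w) - f w) 0 l / l.
    rewrite lintB//; last exact: loc_int_cst.
    rewrite lint_cst ?subr0 ?(ltW l0)//; field; rewrite gt_eqF//.
  rewrite dE normrM normrN normfV (gtr0_norm l0) ler_pdivrMr//.
  have lc : loc_int (fun r : R => f (T r w) - f w).
    by apply: loc_intB => //; exact: loc_int_cst.
  apply: le_trans (lint_norm _ _ lc) _.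
  apply: (@le_trans _ _ (lint (fun=> S w) 0 l)).
    apply: lint_le; [exact: loc_int_norm|exact: loc_int_cst|].
    by move=> r rl; exact: S_bound.
  by rewrite lint_cst ?subr0 ?(ltW l0).
have : nrm2 mu f <= 2 * (nrm2 mu (fun w => f w - lint (orb f w) 0 l / l) +
    nrm2 mu (fun w => lint (orb f w) 0 l / l)).
  apply: le_trans (nrm2D_le LB Lavg); apply: nrm2_le => //; first exact: L2RD.
  by apply: nearW => w; rewrite subrK.
have := gap Lf f_orth; have := nrm2_f_ge; have := nrm2_S; rewrite /n => H1 H2 H3 H4.
have beta0 : beta = 0.
  apply/eqP; rewrite eq_le nrm2_ge0 andbT; lra.
have N0 := nrm2_eq0 (LN l0) beta0.
have L1 : L2R mu (fun=> 1 : R).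
  by apply: (@L2R_bounded _ 1) => // w; rewrite normr1.
have := lint_pairing mu_complete flowT (ltW l0) LA L1 (fun r => aeW _ (fun=> erefl)).
rewrite (_ : (\int[mu]_w _)%E = 0%E); last first.
  rewrite (ae_eq_integral (cst 0%E))//; first exact: integral0.
    have [mN _] := LN l0.
    exact/measurable_EFinP/(measurable_funM mN).
  by apply: filterS N0 => w + _; rewrite /N => ->; rewrite mul0r.
under eq_integral do rewrite mulr1.
rewrite integral_indic// setIT subr0 => /esym/eqP.
by rewrite mule_eq0 eqe gt_eqF//= => /eqP.
Qed.

End tower.

(** * Points without return during a given time interval *)

Lemma ler_dist_sym (R : realDomainType) (a b e : R) :
  a <= b + e -> b <= a + e -> `|a - b| <= e.
Proof. by move=> *; rewrite ler_norml; apply/andP; split; lra. Qed.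

Section return_times.
Context d (Omega : measurableType d) (R : realType).
Context (mu : probability Omega R) (T : R -> Omega -> Omega).
Hypothesis mu_complete : measure_is_complete mu.
Hypothesis flowT : measure_flow mu T.
Notation leb := (@lebesgue_measure R).
Implicit Types (h k : Omega -> R) (F : measurableTypeR R * Omega -> R).
Notation version := (version mu T).
Notation orb h w := (fun r : R => h (T r w)).


(** The set of exceptions is a measurable set, all of whose slices at fixed times are
null by invariance of mu, up to a null set. *)
Lemma joint_ae (P : Omega -> Prop) : {ae mu, forall w, P w} ->
  {ae (leb \x mu)%E, forall z, P (T z.1 z.2)}.
Proof.
move=> [Z [mZ Z0 PZ]].
have [A mA [B nB ABE]] := flow_jointly_measurable flowT mZ.
have A0 : (leb \x mu)%E A = 0%E.
  rewrite /product_measure1; apply: integral0_eq => r _ /=.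
  apply/eqP; rewrite -measure_le0 -Z0 -(flow_preserving flowT r mZ).
  apply: le_measure; rewrite ?inE.
  - exact: measurable_xsection.
  - by rewrite -[X in measurable X]setTI; exact: (flow_measurable flowT).
  - move=> w; rewrite /xsection/= inE => Aw.
    have /seteqP[AZ _] := ABE.
    exact: (AZ (r, w) (or_introl Aw)).
have nA : (leb \x mu)%E.-negligible A by exists A; split.
apply: negligibleS (negligibleU nA nB) => z /= nP.
by have /seteqP[_ /(_ z)] := ABE; apply; apply: PZ.
Qed.

Lemma complete_measurable_set (A B : set Omega) : measurable B ->
  {ae mu, forall w, A w <-> B w} -> measurable A.
Proof.
move=> mB [Z [mZ Z0 ABZ]].
have -> : A = (B `\` Z) `|` (A `&` Z).
  apply/seteqP; split => w.
    move=> Aw; have [Zw|nZw] := pselect (Z w); first by right.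
    left; split => //; suff : A w <-> B w by case => /(_ Aw).
    by apply: contrapT => nAB; apply: nZw; exact: ABZ.
  move=> [[Bw nZw]|[]//]; suff : A w <-> B w by case => _ /(_ Bw).
  by apply: contrapT => nAB; apply: nZw; exact: ABZ.
apply: measurableU; first exact: measurableD.
by apply: mu_complete; exists Z; split => // w [].
Qed.

Variables (u : Omega -> R) (N : set Omega).
Hypothesis mu_u : measurable_fun setT u.
Hypothesis u01 : forall w, 0 <= u w <= 1.
Hypothesis N0 : mu.-negligible N.
Hypothesis u_inj : forall w w', ~ N w -> ~ N w' -> u w = u w' -> w = w'.

Let Q w (x : R) := lint (orb u w) 0 x.

(** Unlike membership in N, this property is invariant under the flow
([nice_flow]). *)
Definition nice w := loc_int (orb u w) /\ {ae leb, forall r, ~ N (T r w)}.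

Let Lu : L2R mu u.
Proof.
apply: (@L2R_bounded _ _ _ mu _ 1) => // w.
by have /andP[u0 u1] := u01 w; rewrite ger0_norm.
Qed.

Lemma nice_ae : {ae mu, forall w, nice w}.
Proof.
have nN : {ae mu, forall w, ~ N w} by apply: negligibleS N0 => w /= /contrapT.
have [_ nNT] := ae_slices (joint_ae nN).
by apply: filterS2 nNT (orbit_loc_int flowT Lu) => w ? [].
Qed.

Lemma nice_flow w s : nice w -> nice (T s w).
Proof.
have E r : T r (T s w) = T (r + s) w by rewrite (flowD flowT).
move=> [lw Nw]; split.
  rewrite (_ : (fun r => _) = (fun r => orb u w (r + s))).
    exact: (loc_int_shift s lw).
  by apply/funext => r; rewrite E.
by apply: leb_ae_imp (ae_shift s Nw) => r; rewrite E.
Qed.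

(** The integrand is between 0 and 1; for negative x the window is empty and Q w x is
0. *)
Lemma Q_lipschitz w (x y : R) : nice w -> `|Q w y - Q w x| <= `|y - x|.
Proof.
move=> [lw _].
wlog xy : x y / x <= y => [H|].
  by have [|/ltW] := leP x y => /H//; rewrite distrC [`|y - x|]distrC.
have Q0 z : z <= 0 -> Q w z = 0.
  rewrite le_eqVlt => /predU1P[->|z0].
    have := lint_cat lw (lexx 0) (lexx 0); rewrite /Q; lra.
  by rewrite /Q /lint set_itv_ge ?bnd_simp -?ltNge// Rintegral_set0.
have QI z z' : 0 <= z -> z <= z' -> 0 <= Q w z' - Q w z <= z' - z.
  move=> z0 zz; rewrite /Q -(lint_cat lw z0 zz) addrAC subrr add0r.
  apply/andP; split; first by apply: lint_ge0 => r _; have /andP[] := u01 (T r w).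
  apply: (@le_trans _ _ (lint (fun=> 1) z z')); last by rewrite lint_cst// mul1r.
  by apply: lint_le => //; [exact: loc_int_cst|move=> r _; have /andP[] := u01 (T r w)].
rewrite [leRHS]ger0_norm ?subr_ge0//.
have [x0|/ltW x0] := leP 0 x.
  by have /andP[? ?] := QI _ _ x0 xy; rewrite ger0_norm.
rewrite (Q0 x x0) subr0.
have [y0|/ltW y0] := leP 0 y; last by rewrite Q0// normr0 subr_ge0.
have := QI _ _ (lexx 0) y0; rewrite (Q0 0 (lexx 0)) !subr0 => /andP[? ?].
by rewrite ger0_norm//; lra.
Qed.

(** The difference of Q (T s w) and Q w at x ([K_flow]), in a form defined and
Lipschitz for all real x and s. *)
Let K w (x s : R) := Q w (x + s) - Q w s - Q w x.

Lemma K_flow w (x s : R) : nice w -> 0 <= x -> 0 <= s -> Q (T s w) x - Q w x = K w x s.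
Proof.
move=> [lw _] x0 s0; rewrite /K; congr (_ - _).
rewrite /Q (_ : (fun r => _) = (fun r => orb u w (r + s))); last first.
  by apply/funext => r; rewrite (flowD flowT).
rewrite (lint_shift s 0 x lw) add0r -(@lint_cat _ _ 0 s (x + s) lw)//.
  by rewrite addrAC subrr add0r.
by rewrite lerDr.
Qed.

Lemma K_periodic w (x s : R) : nice w -> 0 <= x -> 0 <= s -> T s w = w -> K w x s = 0.
Proof. by move=> nw x0 s0 Ts; rewrite -K_flow// Ts subrr. Qed.

(** By Lebesgue differentiation u agrees along the orbits of w and of T s w at almost
every time in ]0, 1[. At one such time both orbits avoid N, so they meet. *)
Lemma K_eq0 w (s : R) : nice w -> 0 <= s -> (forall x : R, 0 <= x <= 1 -> K w x s = 0) ->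
  T s w = w.
Proof.
move=> nw s0 K0; have [lw Nw] := nw; have [lsw Nsw] := nice_flow s nw.
have := lint_eq0_ae (loc_intB lsw lw).
have E (x : R) : 0 <= x <= 1 -> lint (fun r => u (T r (T s w)) - u (T r w)) 0 x = 0.
  move=> x01; transitivity (K w x s); last exact: K0.
  by case/andP: (x01) => x0 _; rewrite -K_flow//; exact: (lintB 0 x lsw lw).
move=> /(_ E) H.
have {}H := leb_ae_and H (leb_ae_and Nw Nsw).
have [r [r0 r1 [ur [n1 n2]]]] : exists r : R, [/\ 0 < r, r < 1 &
   (0 < r < 1 -> u (T r (T s w)) - u (T r w) = 0) /\
   (~ N (T r w)) /\ (~ N (T r (T s w)))].
  apply: contrapT => nr; case: H => Z [mZ Z0 HZ].
  have : (leb `]0%R, 1%R[ <= leb Z)%E.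
    apply: le_measure; rewrite ?inE//= => r /=; rewrite in_itv/= => /andP[r0 r1].
    by apply: HZ => /= Hr; apply: nr; exists r.
  by rewrite Z0 lebesgue_measure_itv/= lte_fin ltr01 oppr0 adde0 lee_fin ler10.
have /eqP := ur (introT andP (conj r0 r1)); rewrite subr_eq0 => /eqP /(u_inj n2 n1).
by move=> /(congr1 (T (- r))); rewrite -!(flowD flowT) ?addrA addNr add0r (flow0 flowT).
Qed.

Lemma K_lipschitz w (x s s' : R) : nice w -> `|K w x s - K w x s'| <= 2 * `|s - s'|.
Proof.
move=> nw; rewrite /K.
have H1 := Q_lipschitz (x + s') (x + s) nw; have H2 := Q_lipschitz s' s nw.
rewrite (_ : _ - _ = (Q w (x + s) - Q w (x + s')) - (Q w s - Q w s')); last by ring.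
apply: le_trans (ler_normB _ _) _.
rewrite (_ : x + s - (x + s') = s - s') in H1; last by ring.
lra.
Qed.

Lemma K_lipschitz2 w (x x' s : R) : nice w -> `|K w x s - K w x' s| <= 2 * `|x - x'|.
Proof.
move=> nw; rewrite /K.
have H1 := Q_lipschitz (x' + s) (x + s) nw; have H2 := Q_lipschitz x' x nw.
rewrite (_ : _ - _ = (Q w (x + s) - Q w (x' + s)) - (Q w x - Q w x')); last by ring.
apply: le_trans (ler_normB _ _) _.
rewrite (_ : x + s - (x' + s) = x - x') in H1; last by ring.
lra.
Qed.

(** The distance between the orbits of w and of T s w. *)
Let delta w (s : R) := sup [set `|K w x s| | x in `[0, 1]].

Let delta_has_sup w (s : R) : nice w -> has_sup [set `|K w x s| | x in `[0, 1]].
Proof.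
move=> nw; split; first by exists `|K w 0 s|; exists 0 => //=; rewrite in_itv/= lexx ler01.
exists (2 + `|K w 0 s|) => _ [x /= + <-]; rewrite in_itv/= => /andP[x0 x1].
have := K_lipschitz2 x 0 s nw; rewrite subr0 (ger0_norm x0) => H.
have := ler_distD 0 (K w x s) 0; rewrite ?subr0.
have := ler_normD (K w x s - K w 0 s) (K w 0 s); rewrite subrK; lra.
Qed.

Let delta_lipschitz w (s s' : R) : nice w -> `|delta w s - delta w s'| <= 2 * `|s - s'|.
Proof.
move=> nw; have H a b : delta w a <= delta w b + 2 * `|a - b|.
  apply: ge_sup; first by have [] := delta_has_sup a nw.
  move=> _ [x /= x01 <-].
  have : `|K w x b| <= delta w b.
    by apply: ub_le_sup; [have [] := delta_has_sup b nw|exists x].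
  have := K_lipschitz x a b nw.
  have := ler_normD (K w x a - K w x b) (K w x b); rewrite subrK; lra.
have H1 := H s s'; have H2 := H s' s; rewrite [`|s' - s|]distrC in H2.
exact: (ler_dist_sym H1 H2).
Qed.

Let delta_continuous w : nice w -> continuous (delta w).
Proof.
move=> nw s; apply/cvgrPdist_le => e e0; near=> t.
apply: le_trans (delta_lipschitz _ _ nw) _.
rewrite -ler_pdivlMl//; near: t.
apply: cvgr_dist_le => //; by rewrite mulr_gt0// invr_gt0.
Unshelve. all: by end_near. Qed.

(** A quantitative form of T s w <> w for all s in ]a, b[, which only involves
countably many times s and countably many measurable functions of w. *)
Definition far (a b : R) (j : nat) : set Omega := \bigcap_(s in [set s : rat | a < ratr s < b])
  \bigcup_(k in `I_j.+2) [set w | j.+1%:R^-1 < `|K w (k%:R / j.+1%:R) (ratr s)|].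

Lemma measurable_K x s : measurable_fun setT (fun w => K w x s).
Proof.
by apply: measurable_funB; first apply: measurable_funB;
  exact: (measurable_lint mu_complete flowT _ _ Lu).
Qed.

Lemma measurable_far a b j : measurable (far a b j).
Proof.
rewrite /far -[X in measurable X]setCK setC_bigcap; apply: measurableC.
rewrite bigcup_mkcond; apply: bigcupT_measurable_rat => s; case: ifPn => // _.
apply: measurableC; apply: bigcup_measurable => k _.
rewrite (_ : [set w | _] = (fun w => `|K w (k%:R / j.+1%:R) (ratr s)|) @^-1` `]j.+1%:R^-1, +oo[).
  rewrite -[X in measurable X]setTI.
  apply: (measurableT_comp (@normr_measurable R setT) (measurable_K _ _)) => //.
by apply/seteqP; split => w /=; rewrite in_itv/= andbT.
Qed.

(** The continuous function delta w is positive on the compact interval [a, b], hence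
bounded below there. *)
Lemma far_intro w (a b : R) : nice w -> 0 <= a -> a <= b ->
  (forall s : R, a <= s <= b -> T s w <> w) -> exists j, far a b j w.
Proof.
move=> nw a0 ab nT.
have [c cab cmin] := EVT_min ab (continuous_subspaceT (delta_continuous nw)).
have c0 : 0 < delta w c.
  rewrite ltNge; apply/negP => dc.
  apply: (nT c); first by move: cab; rewrite in_itv.
  apply: K_eq0 => //; first by move: cab; rewrite in_itv/= => /andP[/(le_trans a0)].
  move=> x x01; apply/eqP; rewrite -normr_le0; apply: le_trans dc.
  by apply: ub_le_sup; [have [] := delta_has_sup c nw|exists x].
(* Rounding x to the grid of mesh 1 / (j + 1) changes K by at most 2 / (j + 1), so
   that a lower bound 4 / (j + 1) of delta leaves room. *)
pose j := Num.truncn (4 / delta w c).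
have j0 : 0 < j.+1%:R :> R by rewrite ltr0n.
have jc : 4 / j.+1%:R < delta w c.
  by rewrite ltr_pdivrMr// mulrC -ltr_pdivrMr//; exact: truncnS_gt.
exists j => s /= /andP[sa sb].
have := cmin (ratr s); rewrite in_itv/= (ltW sa) (ltW sb) => /(_ isT) cs.
have e0 := jc; rewrite -subr_gt0 in e0.
have [_ [x x01 <-] xs] := sup_adherent e0 (delta_has_sup (ratr s) nw).
move: x01; rewrite /= in_itv/= => /andP[x0 x1].
have xj0 : 0 <= x * j.+1%:R by rewrite mulr_ge0// ltW.
have /andP[h1 h2] := truncn_itv xj0.
exists (Num.truncn (x * j.+1%:R)) => /=.
  rewrite ltnS -(ler_nat R); apply: le_trans h1 _.
  by rewrite ler_piMl// ltW.
set y := _ / j.+1%:R.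
have : `|x - y| <= j.+1%:R^-1.
  rewrite /y -(ler_pM2r j0) mulVf ?gt_eqF// -[X in _ * X](gtr0_norm j0) -normrM.
  rewrite mulrBl divfK ?gt_eqF//.
  rewrite -[X in _ < X]natr1 in h2; apply: ler_dist_sym; first exact: ltW.
  by apply: le_trans h1 _; rewrite lerDl.
have := K_lipschitz2 x y (ratr s) nw.
have := ler_normD (K w x (ratr s) - K w y (ratr s)) (K w y (ratr s)); rewrite subrK.
rewrite -/(delta w (ratr s)) in xs.
move: xs cs; set p := j.+1%:R^-1; set D1 := `|K w x _|; set D2 := `|K w y _|.
set D3 := `|_ - _|; set D4 := `|x - y|.
have : 0 < p by rewrite invr_gt0.
clearbody p D1 D2 D3 D4; move: (delta w c) (delta w (ratr s)) => dc ds; lra.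
Qed.

(** Any real s has rational times of ]a, b[ within 1 / (4 (j + 1)) of it, where K
differs by at most 1 / (2 (j + 1)). *)
Lemma far_elim w (a b : R) j (s : R) : nice w -> far a b j w -> a < s -> s < b ->
  exists2 k : nat, (k < j.+2)%N & (2 * j.+1%:R)^-1 < `|K w (k%:R / j.+1%:R) s|.
Proof.
move=> nw fw sa sb; have j0 : 0 < j.+1%:R :> R by rewrite ltr0n.
have : s < Num.min b (s + (4 * j.+1%:R)^-1).
  by rewrite lt_min sb ltrDl invr_gt0 mulr_gt0.
move=> /rat_in_itvoo[q]; rewrite in_itv/= => /andP[sq]; rewrite lt_min => /andP[qb qs].
have [] := fw q; first by rewrite /= (lt_trans sa sq) qb.
move=> k /= kj kK; exists k => //.
have := K_lipschitz (k%:R / j.+1%:R) (ratr q) s nw.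
have := ler_normD (K w (k%:R / j.+1%:R) (ratr q) - K w (k%:R / j.+1%:R) s) (K w (k%:R / j.+1%:R) s).
rewrite subrK (gtr0_norm (_ : 0 < ratr q - s)) ?subr_gt0//.
move: kK qs; rewrite !invfM.
set p := j.+1%:R^-1; set D1 := `|K w _ (ratr q)|; set D2 := `|K w _ s|.
set D3 := `|_ - _|; lra.
Qed.

Lemma far_nonperiodic w (a b : R) j (s : R) : nice w -> far a b j w -> 0 <= a -> a < s ->
  s < b -> T s w <> w.
Proof.
move=> nw fw a0 sa sb Ts; have [k _] := far_elim nw fw sa sb.
rewrite K_periodic ?normr0 ?divr_ge0//; last by rewrite ltW// (le_lt_trans a0).
by rewrite ltNge invr_ge0 mulr_ge0.
Qed.

(** Two points of the same cell have values of Q within 1 / (2 (j + 1)) of each other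
at the grid points used by [far]. *)
Definition cell j (c : seq nat) : set Omega := \bigcap_(k in `I_j.+2)
  [set w | (nth 0%N c k)%:R <= 2 * j.+1%:R * Q w (k%:R / j.+1%:R) < (nth 0%N c k).+1%:R].

Lemma measurable_cell j c : measurable (cell j c).
Proof.
apply: bigcap_measurable; first by exists 0%N.
move=> k _; rewrite (_ : [set w | _] = (fun w => 2 * j.+1%:R * Q w (k%:R / j.+1%:R)) @^-1`
  `[(nth 0%N c k)%:R, (nth 0%N c k).+1%:R[).
  rewrite -[X in measurable X]setTI.
  have mQ : measurable_fun setT (fun w => 2 * j.+1%:R * Q w (k%:R / j.+1%:R)).
    exact: (measurable_funM (measurable_cst _)
      (measurable_lint mu_complete flowT _ _ Lu)).
  exact: mQ.
by apply/seteqP; split => w /=; rewrite in_itv.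
Qed.

Lemma cell_cover j w : exists c, cell j c w.
Proof.
exists (mkseq (fun i => Num.truncn (2 * j.+1%:R * Q w (i%:R / j.+1%:R))) j.+2).
move=> k /= kj; rewrite nth_mkseq//; apply: truncn_itv.
by rewrite !mulr_ge0// lint_ge0// => r _; have /andP[] := u01 (T r w).
Qed.

Lemma far_cell_separated (a b : R) j c w (s : R) : nice w -> 0 <= a -> far a b j w ->
  cell j c w -> a < s -> s < b -> ~ cell j c (T s w).
Proof.
move=> nw a0 fw cw sa sb cs; have [k kj] := far_elim nw fw sa sb.
have j0 : 0 < j.+1%:R :> R by rewrite ltr0n.
have s0 : 0 <= s by rewrite ltW// (le_lt_trans a0).
rewrite -K_flow ?divr_ge0//; move: (cw k kj) (cs k kj) => /=.
set q := Q w _; set q' := Q (T s w) _ => /andP[c1 c2] /andP[c3 c4].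
rewrite -(ltr_pM2l (_ : 0 < 2 * j.+1%:R)) ?mulr_gt0// mulfV ?gt_eqF ?mulr_gt0//.
rewrite -[X in X * _](gtr0_norm (_ : 0 < 2 * j.+1%:R)) ?mulr_gt0// -normrM mulrBr.
rewrite -natr1 in c2 c4; apply/negP; rewrite -leNgt ler_norml; apply/andP; split; lra.
Qed.

End return_times.

(** * The period *)

Section essential_period.
Context d (Omega : measurableType d) (R : realType).
Context (mu : probability Omega R) (T : R -> Omega -> Omega).
Hypothesis mu_complete : measure_is_complete mu.
Hypothesis flowT : measure_flow mu T.
Notation leb := (@lebesgue_measure R).
Implicit Types (h k : Omega -> R) (F : measurableTypeR R * Omega -> R).
Notation version := (version mu T).
Notation orb h w := (fun r : R => h (T r w)).


Variables (u : Omega -> R) (N : set Omega).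
Hypothesis mu_u : measurable_fun setT u.
Hypothesis u01 : forall w, 0 <= u w <= 1.
Hypothesis N0 : mu.-negligible N.
Hypothesis u_inj : forall w w', ~ N w -> ~ N w' -> u w = u w' -> w = w'.

Notation nice := (nice T u N).
Notation far := (far T u).
Notation cell := (cell T u).

Let nice_mu : {ae mu, forall w, nice w}.
Proof. exact: nice_ae. Qed.

Lemma le_periodP w (c : R) :
  (c%:E <= period T w)%E <-> (forall s : R, 0 < s -> s < c -> T s w <> w).
Proof.
split=> [cp s s0 sc Ts|H].
  have : (period T w <= s%:E)%E by apply: ereal_inf_lbound; exists s.
  by move=> /(le_trans cp); rewrite lee_fin leNgt sc.
apply: le_ereal_inf_tmp => _ [s /= [s0 Ts] <-]; rewrite lee_fin leNgt.
by apply/negP => sc; exact: (H s s0 sc).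
Qed.

(** The intervals ]1 / n, c - 1 / n[ exhaust ]0, c[. *)
Lemma le_period_far w (c : R) : nice w ->
  (c%:E <= period T w)%E <->
  (\bigcap_n \bigcup_j far n.+1%:R^-1 (c - n.+1%:R^-1) j) w.
Proof.
move=> nw; rewrite le_periodP; split=> [H n _|H s s0 sc Ts].
  have n0 : 0 < n.+1%:R^-1 :> R by rewrite invr_gt0 ltr0n.
  have [nc|cn] := leP n.+1%:R^-1 (c - n.+1%:R^-1).
    have [|j fj] := far_intro flowT u01 u_inj nw (ltW n0) nc.
      move: n0; set p := n.+1%:R^-1 => p0 s /andP[s1 s2].
      by apply: H; [exact: lt_le_trans s1|lra].
    by exists j.
  exists 0%N => // q /= /andP[q1 q2]; exfalso.
  by have := lt_trans (lt_trans q1 q2) cn; rewrite ltxx.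
pose e := Num.min s (c - s).
have e0 : 0 < e by rewrite lt_min s0 subr_gt0.
pose n := Num.truncn e^-1.
have ne : n.+1%:R^-1 < e.
  by rewrite invf_plt ?posrE// ?ltr0n//; exact: truncnS_gt.
have [j _ fj] := H n I.
move: ne; rewrite lt_min => /andP[ne1 ne2].
have sc' : s < c - n.+1%:R^-1 by rewrite ltrBrDr -ltrBrDl.
apply: (far_nonperiodic flowT u01 nw fj _ ne1 _ Ts).
  by rewrite invr_ge0.
exact: sc'.
Qed.

Lemma measurable_period : measurable_fun setT (period T).
Proof.
apply: (measurability _ (ErealGenCInfty.measurableE R)) => //.
move=> _ [_ [c ->] <-]; rewrite setTI.
apply: (complete_measurable_set mu_complete
  (B := \bigcap_n \bigcup_j far n.+1%:R^-1 (c - n.+1%:R^-1) j)).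
  apply: bigcapT_measurable => n; apply: bigcupT_measurable => j.
  exact: (measurable_far mu_complete flowT mu_u u01).
apply: filterS nice_mu => w nw; rewrite -le_period_far//=.
by rewrite in_itv/= andbT.
Qed.

Variable l : R.
Hypothesis l0 : 0 < l.
Hypothesis gap : forall f, L2R mu f ->
  (forall k, L2R mu k -> (forall r, {ae mu, forall w, k (T r w) = k w}) ->
     (\int[mu]_w (f w * k w)%:E = 0)%E) ->
  4 * nrm2 mu (fun w => lint (orb f w) 0 l / l) <= nrm2 mu f.

(** Intersected with a cell and with the nice points, [far] is a set without returns
to itself, to which [tower_null] applies; countably many cells cover it. *)
Lemma far_negligible j : mu.-negligible (far l (200 * l) j).
Proof.
have mnice : measurable [set w | nice w].
  apply: (complete_measurable_set mu_complete measurableT).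
  by apply: filterS nice_mu => w nw; split.
pose A c := far l (200 * l) j `&` cell j c `&` [set w | nice w].
have A0 c : mu.-negligible (A c).
  have mA : measurable (A c).
    apply: measurableI => //; apply: measurableI; first exact: (measurable_far mu_complete flowT mu_u u01).
    exact: (measurable_cell mu_complete flowT mu_u u01).
  apply/negligibleP => //; apply: (tower_null mu_complete flowT l0 mA gap).
  move=> w s [[fw cw] nw] ls sl [[_ csw] _].
  exact: (far_cell_separated flowT u01 nw (ltW l0) fw cw ls sl csw).
pose B n := if unpickle n is Some c then A c else set0.
have B0 : mu.-negligible (\bigcup_n B n).
  apply: negligible_bigcup => n; rewrite /B; case: unpickle => [c|].
    exact: A0.
  exact: negligible_set0.
apply: negligibleS (negligibleU nice_mu B0) => w fw.
have [nw|nw] := pselect (nice w); [right|by left].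
have [c cw] := cell_cover T u01 j w.
by exists (pickle c) => //; rewrite /B pickleK.
Qed.

Lemma return_ae : {ae mu, forall w, exists2 s, l <= s <= 200 * l & T s w = w}.
Proof.
have F0 := negligible_bigcup far_negligible.
apply: negligibleS (negligibleU nice_mu F0) => w /= nr.
have [nw|nw] := pselect (nice w); [right|by left].
have ll : l <= 200 * l by move: l0; lra.
have [|j fj] := far_intro flowT u01 u_inj nw (ltW l0) ll; last by exists j.
by move=> s sl Ts; apply: nr; exists s.
Qed.

Lemma period_bounded : in_Linfty mu (period T).
Proof.
have per_le : {ae mu, forall w, (0 <= period T w <= (200 * l)%:E)%E}.
  apply: filterS return_ae => w [s /andP[ls sl] Ts]; apply/andP; split.
    by apply/le_periodP => r r0 /(lt_trans r0); rewrite ltxx.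
  apply: (@le_trans _ _ s%:E); last by rewrite lee_fin.
  by apply: ereal_inf_lbound; exists s => //; split => //; exact: lt_le_trans ls.
exists (fine \o period T).
  rewrite inE; apply/andP; split.
    rewrite inE/=; apply: (measurableT_comp (fine_measurable measurableT)).
    exact: measurable_period.
  rewrite inE/= /finite_norm unlock.
  case: ifPn => _; last by rewrite ltry.
  apply: (@le_lt_trans _ _ (200 * l)%:E); last by rewrite ltry.
  apply/ess_supP; apply: filterS per_le => w /andP[p0 p1] /=.
  have pf : period T w \is a fin_num by rewrite ge0_fin_numE// (le_lt_trans p1)// ltry.
  by rewrite ger0_norm ?fine_ge0// fineK.
apply: filterS per_le => w /andP[p0 p1] /=.
by rewrite fineK// ge0_fin_numE// (le_lt_trans p1)// ltry.
Qed.

End essential_period.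

(** * Complex-valued functions and the projection onto the fixed functions *)

Section complex_L2.
Context d (Omega : measurableType d) (R : realType).
Context (mu : probability Omega R).
Implicit Types f g h : Omega -> R[i].

Definition Ref f w : R := complex.Re (f w).
Definition Imf f w : R := complex.Im (f w).

(** The squared norm of the complex-valued function f ([L2norm_energy]). *)
Definition energy f : R := nrm2 mu (Ref f) + nrm2 mu (Imf f).

Lemma energy_ge0 f : 0 <= energy f.
Proof. by rewrite addr_ge0 ?nrm2_ge0. Qed.

Lemma L2norm_sqr f : (L2norm mu f `^ 2 = \int[mu]_w (Ref f w ^+ 2 + Imf f w ^+ 2)%:E)%E.
Proof.
rewrite /L2norm poweR_Lnorm//; apply: eq_integral => w _.
rewrite /Ref /Imf; case: (f w) => a b /=.
rewrite ger0_norm ?sqrtr_ge0// powR_mulrn ?sqrtr_ge0//.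
by rewrite sqr_sqrtr// addr_ge0// sqr_ge0.
Qed.

Lemma in_L2P f : in_L2 mu f <-> L2R mu (Ref f) /\ L2R mu (Imf f).
Proof.
split.
- move=> [mr mi fin].
  have : (\int[mu]_w (Ref f w ^+ 2 + Imf f w ^+ 2)%:E < +oo)%E.
    by rewrite -L2norm_sqr poweR_lty.
  move=> I2.
  have i2 : mu.-integrable setT (fun w => (Ref f w ^+ 2 + Imf f w ^+ 2)%:E).
    apply/integrableP; split.
      by apply/measurable_EFinP; apply: measurable_funD; exact: measurable_funX.
    under eq_integral do rewrite gee0_abs ?lee_fin ?addr_ge0 ?sqr_ge0//.
    exact: I2.
  have le (g : Omega -> R) : measurable_fun setT g -> (forall w, g w ^+ 2 <= Ref f w ^+ 2 + Imf f w ^+ 2) ->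
      L2R mu g.
    move=> mg gf; split => //; apply: le_integrable i2 => //.
      by apply/measurable_EFinP; exact: measurable_funX.
    by move=> w _; rewrite lee_fin !ger0_norm ?addr_ge0 ?sqr_ge0.
  split; apply: le => // w; first by rewrite lerDl sqr_ge0.
  by rewrite lerDr sqr_ge0.
- move=> [[mr ir] [mi ii]]; split => //.
  have : (L2norm mu f `^ 2 < +oo)%E.
    rewrite L2norm_sqr; have := integrable_fin_num measurableT (integrableD measurableT ir ii).
    by rewrite fin_numElt => /andP[_].
  have := Lnorm_ge0 mu 2%:E (fun w => (Normc.normc (f w))%:E).
  rewrite -/(L2norm mu f); case: (L2norm mu f) => [r|//|//] _; rewrite ?ltry//.
  by rewrite poweRyr// ltxx.
Qed.

Lemma L2norm_energy f : in_L2 mu f -> L2norm mu f = (Num.sqrt (energy f))%:E.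
Proof.
move=> /in_L2P [Lr Li].
have E : (L2norm mu f `^ 2 = (energy f)%:E)%E.
  rewrite L2norm_sqr /energy EFinD -!nrm2E// -ge0_integralD//.
  - by move=> w _; rewrite lee_fin sqr_ge0.
  - by case: Lr => _; exact: measurable_int.
  - by move=> w _; rewrite lee_fin sqr_ge0.
  - by case: Li => _; exact: measurable_int.
have := Lnorm_ge0 mu 2%:E (fun w => (Normc.normc (f w))%:E).
rewrite -/(L2norm mu f); move: E; case: (L2norm mu f) => [r||//].
- move=> [E]; rewrite lee_fin => r0; congr EFin.
  by move: E; rewrite powR_mulrn// => <-; rewrite sqrtr_sqr ger0_norm.
- by rewrite poweRyr.
Qed.

Lemma inner_Re f h : complex.Re (L2inner mu f h) =
  \int[mu]_w (Ref f w * Ref h w + Imf f w * Imf h w).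
Proof.
rewrite /L2inner /Cintegral /=; apply: eq_Rintegral => w _; rewrite /Ref /Imf.
by case: (f w) => a b; case: (h w) => x y /=; rewrite mulrN opprK.
Qed.

Lemma inner_Im f h : complex.Im (L2inner mu f h) =
  \int[mu]_w (Imf f w * Ref h w - Ref f w * Imf h w).
Proof.
rewrite /L2inner /Cintegral /=; apply: eq_Rintegral => w _; rewrite /Ref /Imf.
by case: (f w) => a b; case: (h w) => x y /=; rewrite mulrN addrC.
Qed.

(** The real and imaginary parts of the inner product are combinations of the four
real pairings. *)
Lemma inner0 f h : in_L2 mu h -> in_L2 mu f ->
  (forall k, k = Ref h \/ k = Imf h ->
    (\int[mu]_w (Ref f w * k w)%:E = 0 /\ \int[mu]_w (Imf f w * k w)%:E = 0)%E) ->
  L2inner mu f h = 0.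
Proof.
move=> /in_L2P[hr hi] /in_L2P[fr fi] H.
have [H1 H2] := H _ (or_introl erefl); have [H3 H4] := H _ (or_intror erefl).
apply/eqP; rewrite eq_complex inner_Re inner_Im /=.
have I a b : L2R mu a -> L2R mu b -> mu.-integrable setT (EFin \o (fun w => a w * b w)).
  exact: L2R_mul.
rewrite RintegralD ?RintegralB//; try exact: I.
by rewrite /Rintegral H1 H2 H3 H4 /= addr0 subr0 eqxx.
Qed.

Context (T : R -> Omega -> Omega).
Hypothesis flowT : measure_flow mu T.

Lemma flow_fixedP h : flow_fixed mu T h <->
  [/\ in_L2 mu h, (forall r, {ae mu, forall w, Ref h (T r w) = Ref h w}) &
    (forall r, {ae mu, forall w, Imf h (T r w) = Imf h w})].
Proof.
split.
- move=> [Lh hT]; split => // r; apply: filterS (hT r) => w;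
  by rewrite /koopman /= /Ref /Imf => ->.
- move=> [Lh hr hi]; split => // r; apply: filterS2 (hr r) (hi r) => w.
  rewrite /koopman /= /Ref /Imf; case: (h (T r w)) (h w) => a b [x y] /= -> ->.
  done.
Qed.

Lemma in_L2B f g : in_L2 mu f -> in_L2 mu g -> in_L2 mu (fun w => f w - g w).
Proof.
move=> /in_L2P[fr fi] /in_L2P[gr gi]; apply/in_L2P; split.
- rewrite (_ : Ref _ = fun w => Ref f w - Ref g w); first exact: L2RB.
  by apply/funext => w; rewrite /Ref; case: (f w) (g w) => a b [].
- rewrite (_ : Imf _ = fun w => Imf f w - Imf g w); first exact: L2RB.
  by apply/funext => w; rewrite /Imf; case: (f w) (g w) => a b [].
Qed.

(** Two projections of f differ by a fixed function orthogonal to itself. *)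
Lemma fixed_proj_unique f g1 g2 : in_L2 mu f ->
  is_fixed_proj mu T f g1 -> is_fixed_proj mu T f g2 ->
  {ae mu, forall w, g1 w = g2 w}.
Proof.
move=> Lf [fx1 o1] [fx2 o2].
have /flow_fixedP[L1 r1 i1] := fx1; have /flow_fixedP[L2 r2 i2] := fx2.
set h : Omega -> R[i] := fun w => g1 w - g2 w.
have RE w : Ref h w = Ref g1 w - Ref g2 w.
  by rewrite /Ref /h; case: (g1 w) (g2 w) => a b [].
have IE w : Imf h w = Imf g1 w - Imf g2 w.
  by rewrite /Imf /h; case: (g1 w) (g2 w) => a b [].
have Lh : in_L2 mu h by exact: in_L2B.
have fxh : flow_fixed mu T h.
  apply/flow_fixedP; split => // r.
    by apply: filterS2 (r1 r) (r2 r) => w e1 e2; rewrite !RE e1 e2.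
  by apply: filterS2 (i1 r) (i2 r) => w e1 e2; rewrite !IE e1 e2.
have := congr1 (@complex.Re R) (o1 h fxh); have := congr1 (@complex.Re R) (o2 h fxh).
rewrite !inner_Re /= => H2 H1.
have [hr hi] := (in_L2P h).1 Lh.
have [D1r D1i] := (in_L2P _).1 (in_L2B Lf L1).
have [D2r D2i] := (in_L2P _).1 (in_L2B Lf L2).
have I a b a' b' : L2R mu a -> L2R mu b -> L2R mu a' -> L2R mu b' ->
    mu.-integrable setT (EFin \o (fun w => a w * b w + a' w * b' w)).
  move=> *; apply: (integrableD measurableT (f := fun w => (a w * b w)%:E)
    (g := fun w => (a' w * b' w)%:E)); exact: L2R_mul.
have : nrm2 mu (Ref h) + nrm2 mu (Imf h) = 0.
  rewrite /nrm2 -RintegralD//; [|by case: hr|by case: hi].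
  rewrite -[RHS](subrr 0) -[X in _ = X - _]H2 -[X in _ = _ - X]H1.
  rewrite -RintegralB//; try exact: I.
  apply: eq_Rintegral => w _; rewrite /= RE IE /Ref /Imf.
  by case: (f w) (g1 w) (g2 w) => a b [a1 b1] [a2 b2] /=; ring.
move=> /eqP; rewrite paddr_eq0 ?nrm2_ge0// => /andP[/eqP n1 /eqP n2].
apply: filterS2 (nrm2_eq0 hr n1) (nrm2_eq0 hi n2) => w.
rewrite RE IE /Ref /Imf; case: (g1 w) (g2 w) => a b [x y] /=.
by move=> /eqP; rewrite subr_eq0 => /eqP -> /eqP; rewrite subr_eq0 => /eqP ->.
Qed.

Lemma fixed_projP f g : in_L2 mu f -> is_fixed_proj mu T f g ->
  in_L2 mu (fixed_proj mu T f) /\ {ae mu, forall w, fixed_proj mu T f w = g w}.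
Proof.
move=> Lf fg; have : is_fixed_proj mu T f (fixed_proj mu T f).
  exact: (@xgetPex _ (fun=> 0) [set g | is_fixed_proj mu T f g] (ex_intro _ g fg)).
by move=> H; split; [case: H => -[]|exact: (fixed_proj_unique Lf H fg)].
Qed.

Lemma Ref_average t s f w :
  Ref (ergodic_average T t s f) w = lint (fun r => Ref f (T r w)) s t / (t - s).
Proof. by rewrite /Ref /ergodic_average /Cintegral /= mul0r subr0 mulrC. Qed.

Lemma Imf_average t s f w :
  Imf (ergodic_average T t s f) w = lint (fun r => Imf f (T r w)) s t / (t - s).
Proof. by rewrite /Imf /ergodic_average /Cintegral /= mul0r addr0 mulrC. Qed.

End complex_L2.

(** * The two implications *)

Section main_directions.
Context d (Omega : measurableType d) (R : realType).
Context (mu : probability Omega R) (T : R -> Omega -> Omega).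
Hypothesis mu_complete : measure_is_complete mu.
Hypothesis flowT : measure_flow mu T.
Notation leb := (@lebesgue_measure R).
Implicit Types (h k : Omega -> R) (F : measurableTypeR R * Omega -> R).
Notation version := (version mu T).
Notation orb h w := (fun r : R => h (T r w)).


Lemma in_L2_average t s f : s < t -> in_L2 mu f -> in_L2 mu (ergodic_average T t s f).
Proof.
move=> st /in_L2P[fr fi]; apply/in_L2P; split.
- rewrite (_ : Ref _ = fun w => (t - s)^-1 * lint (fun r => Ref f (T r w)) s t).
    by apply: L2RZ; exact: L2R_lint.
  by apply/funext => w; rewrite Ref_average mulrC.
- rewrite (_ : Imf _ = fun w => (t - s)^-1 * lint (fun r => Imf f (T r w)) s t).
    by apply: L2RZ; exact: L2R_lint.
  by apply/funext => w; rewrite Imf_average mulrC.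
Qed.

Lemma Ref_sub (f g : Omega -> R[i]) w : Ref (fun w => f w - g w) w = Ref f w - Ref g w.
Proof. by rewrite /Ref; case: (f w) (g w) => a b []. Qed.

Lemma Imf_sub (f g : Omega -> R[i]) w : Imf (fun w => f w - g w) w = Imf f w - Imf g w.
Proof. by rewrite /Imf; case: (f w) (g w) => a b []. Qed.

(** The period is an infimum, which need not be attained, hence a bound slightly
larger than the essential supremum of the period. *)
Lemma period_return : in_Linfty mu (period T) -> exists2 M : R, 0 < M &
  {ae mu, forall w, exists p : R, [/\ 0 < p, p <= M & T p w = w]}.
Proof.
move=> [g]; rewrite inE => /andP[_]; rewrite inE/= /finite_norm unlock.
have mu1 : (0 < mu [set: Omega])%E by rewrite probability_setT lte01.
rewrite mu1 => gfin perg.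
have gM := ess_sup_ge mu (abse \o (EFin \o g)).
have [M MgE] : exists M : R, (ess_sup mu (abse \o (EFin \o g)) <= M%:E)%E.
  case: (ess_sup _ _) gfin => [r|//|] _; first by exists r.
  by exists 0; rewrite leNye.
exists (`|M| + 1); first by rewrite ltr_wpDl.
apply: filterS2 gM perg => w /= gw pw.
have : (period T w < (`|M| + 1)%:E)%E.
  rewrite pw lte_fin; move: (le_trans gw MgE); rewrite lee_fin => gwM.
  apply: le_lt_trans (ler_norm _) _; apply: le_lt_trans gwM _.
  by apply: le_lt_trans (ler_norm _) _; rewrite ltrDl.
move=> /ereal_inf_lt[_ [p /= [p0 Tp] <-]]; rewrite lte_fin => pM.
by exists p; split => //; exact: ltW.
Qed.

Lemma bounded_period_uniform : in_Linfty mu (period T) -> uniform_ergodic mu T.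
Proof.
move=> /period_return[M M0 per] e e0.
exists (4 * M / e) => t s st Lts.
have ts0 : 0 < t - s by rewrite subr_gt0.
apply: (@le_lt_trans _ _ (2 * M / (t - s))%:E); last first.
  rewrite lte_fin ltr_pdivrMr//; move: Lts; rewrite ltr_pdivrMr//.
  have : 0 < (t - s) * e by rewrite mulr_gt0.
  rewrite [e * _]mulrC; lra.
apply: ge_ereal_sup => _ [f [Lf f1] <-].
have [fr fi] := (in_L2P mu f).1 Lf.
pose g w := Complex (time_limit T (Ref f) w) (time_limit T (Imf f) w).
have Lgr := time_limit_L2 mu_complete flowT M0 per fr.
have Lgi := time_limit_L2 mu_complete flowT M0 per fi.
have Lg : in_L2 mu g by apply/in_L2P; split; [exact: Lgr|exact: Lgi].
have fg : is_fixed_proj mu T f g.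
  split.
    apply/flow_fixedP; split => // r.
      exact: (time_limit_fixed flowT per r fr).
    exact: (time_limit_fixed flowT per r fi).
  move=> h /flow_fixedP[Lh hr hi].
  have [Lhr Lhi] := (in_L2P mu h).1 Lh.
  apply: inner0 => //; first exact: in_L2B.
  have E1 : Ref (fun w => f w - g w) = fun w => Ref f w - time_limit T (Ref f) w.
    by apply/funext => w; rewrite Ref_sub.
  have E2 : Imf (fun w => f w - g w) = fun w => Imf f w - time_limit T (Imf f) w.
    by apply/funext => w; rewrite Imf_sub.
  rewrite E1 E2 => k [->|->]; split.
  - exact: (time_limit_pairing mu_complete flowT M0 per fr Lhr hr).
  - exact: (time_limit_pairing mu_complete flowT M0 per fi Lhr hr).
  - exact: (time_limit_pairing mu_complete flowT M0 per fr Lhi hi).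
  - exact: (time_limit_pairing mu_complete flowT M0 per fi Lhi hi).
have [Lp pg] := fixed_projP Lf fg.
have La := in_L2_average st Lf.
have LD := in_L2B La Lp.
rewrite (L2norm_energy LD) lee_fin.
have energy1 : energy mu f <= 1.
  move: f1; rewrite (L2norm_energy Lf) lee_fin => f1.
  by rewrite -(sqr_sqrtr (energy_ge0 mu f)) -(expr1n R 2) ler_sqr ?nnegrE ?sqrtr_ge0.
have K0 : 0 <= 2 * M / (t - s) by rewrite divr_ge0 ?mulr_ge0// ltW.
have [LDr LDi] := (in_L2P mu _).1 LD.
have part h (D : Omega -> R) : L2R mu h -> L2R mu D ->
    {ae mu, forall w, D w = lint (orb h w) s t / (t - s) - time_limit T h w} ->
    nrm2 mu D <= (2 * M / (t - s)) ^+ 2 * nrm2 mu h.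
  move=> Lh LD' DE; have [H LH] := time_limit_L2_dist mu_complete flowT M0 per Lh st.
  rewrite (nrm2_eq LD' LH DE) -lee_fin EFinM -(nrm2E Lh) -(nrm2E LH); exact: H.
have pr : nrm2 mu (Ref (fun w => ergodic_average T t s f w - fixed_proj mu T f w)) <=
    (2 * M / (t - s)) ^+ 2 * nrm2 mu (Ref f).
  apply: part => //; apply: filterS pg => w pw.
  by rewrite Ref_sub Ref_average {2}/Ref pw.
have pi : nrm2 mu (Imf (fun w => ergodic_average T t s f w - fixed_proj mu T f w)) <=
    (2 * M / (t - s)) ^+ 2 * nrm2 mu (Imf f).
  apply: part => //; apply: filterS pg => w pw.
  by rewrite Imf_sub Imf_average {2}/Imf pw.
rewrite -(ger0_norm K0) -sqrtr_sqr ler_wsqrtr//.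
apply: le_trans (lerD pr pi) _; rewrite -mulrDr.
by rewrite ler_piMr ?sqr_ge0.
Qed.

(** The projection of f vanishes, and the uniform estimate with constant 1 / 2 applies
to f divided by its norm. *)
Lemma uniform_gap : uniform_ergodic mu T -> exists2 l : R, 0 < l &
  forall f : Omega -> R, L2R mu f ->
  (forall k, L2R mu k -> (forall r, {ae mu, forall w, k (T r w) = k w}) ->
     (\int[mu]_w (f w * k w)%:E = 0)%E) ->
  4 * nrm2 mu (fun w => lint (orb f w) 0 l / l) <= nrm2 mu f.
Proof.
move=> uni; have [|L HL] := uni (2^-1 : R); first by rewrite invr_gt0.
pose l : R := `|L| + 1.
have l0 : 0 < l by rewrite ltr_wpDl.
have Ll : L < l - 0 by rewrite subr0 (le_lt_trans (ler_norm L))// ltrDl.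
have opl := HL l 0 l0 Ll.
exists l => // f Lf forth.
have LA : L2R mu (fun w => l^-1 * lint (orb f w) 0 l) by apply: L2RZ; exact: L2R_lint.
have LA' : L2R mu (fun w => lint (orb f w) 0 l / l).
  by rewrite (_ : (fun w => _) = fun w => l^-1 * lint (orb f w) 0 l)//; apply/funext => w; rewrite mulrC.
have [f0|f0] := eqVneq (nrm2 mu f) 0.
  have := lint_contraction mu_complete flowT l0 Lf.
  rewrite (nrm2E Lf) f0 mule0 (nrm2E (L2R_lint mu_complete flowT l0 Lf)) lee_fin => H.
  have -> : nrm2 mu (fun w => lint (orb f w) 0 l / l) =
      l^-1 ^+ 2 * nrm2 mu (fun w => lint (orb f w) 0 l).
    rewrite -nrm2Z; last exact: L2R_lint.
    by congr nrm2; apply/funext => w; rewrite mulrC.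
  have -> : nrm2 mu (fun w => lint (orb f w) 0 l) = 0.
    by apply/eqP; rewrite eq_le nrm2_ge0 andbT.
  by rewrite !mulr0.
have fpos : 0 < nrm2 mu f by rewrite lt_neqAle eq_sym f0 nrm2_ge0.
pose c := (Num.sqrt (nrm2 mu f))^-1.
have c2 : c ^+ 2 * nrm2 mu f = 1 by rewrite exprVn sqr_sqrtr ?ltW// mulVf.
pose F w : R[i] := Complex (c * f w) 0.
have L0 : L2R mu (fun=> 0 : R) by apply: (@L2R_bounded _ _ _ mu _ 0) => // w; rewrite normr0.
have LcF : L2R mu (fun w => c * f w) by exact: L2RZ.
have LF : in_L2 mu F by apply/in_L2P.
have n0 : nrm2 mu (fun=> 0 : R) = 0.
  by rewrite /nrm2 (_ : (fun=> _) = cst 0) ?Rintegral_cst ?mul0r//; apply/funext => w; rewrite expr0n.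
have energyF : energy mu F = 1.
  by rewrite /energy /Ref /Imf /F /= nrm2Z// c2 n0 addr0.
have LZ : in_L2 mu (fun=> 0 : R[i]) by apply/in_L2P.
have pF : is_fixed_proj mu T F (fun=> 0).
  split; first by apply/flow_fixedP; split => // r; exact: aeW.
  move=> h /flow_fixedP[Lh hr hi].
  have [Lhr Lhi] := (in_L2P mu h).1 Lh.
  apply: inner0 => //; first exact: in_L2B.
  have E1 : Ref (fun w => F w - 0) = fun w => c * f w.
    by apply/funext => w; rewrite Ref_sub /Ref /= subr0.
  have E2 : Imf (fun w => F w - 0) = fun=> 0.
    by apply/funext => w; rewrite Imf_sub /Imf /= subr0.
  rewrite E1 E2 => k kh; split; last by apply: integral0_eq => w _; rewrite mul0r.
  have [Lk kT] : L2R mu k /\ forall r, {ae mu, forall w, k (T r w) = k w}.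
    by case: kh => ->.
  under eq_integral do rewrite -mulrA EFinM.
  by rewrite integralZl//; [rewrite forth// mule0|exact: L2R_mul].
have [Lp p0] := fixed_projP LF pF.
have La := in_L2_average l0 LF.
pose D : Omega -> R[i] := fun w => ergodic_average T l 0 F w - fixed_proj mu T F w.
have LD : in_L2 mu D by exact: (in_L2B La Lp).
have : (L2norm mu D < (2^-1)%:E)%E.
  apply: le_lt_trans opl; apply: ereal_sup_ubound; exists F => //; split => //.
  by rewrite (L2norm_energy LF) energyF sqrtr1.
rewrite (L2norm_energy LD) lte_fin => H.
have {}H : energy mu D < 4^-1.
  rewrite -(sqr_sqrtr (energy_ge0 mu _)).
  have -> : 4^-1 = (2^-1) ^+ 2 :> R by field.
  by rewrite ltr_sqr ?nnegrE ?sqrtr_ge0.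
have [LDr LDi] := (in_L2P mu _).1 LD.
have E : nrm2 mu (Ref D) =
    c ^+ 2 * nrm2 mu (fun w => lint (orb f w) 0 l / l).
  rewrite -nrm2Z//; apply: nrm2_eq => //; first exact: L2RZ.
  apply: filterS2 p0 (orbit_loc_int flowT Lf) => w pw [lw _].
  rewrite Ref_sub Ref_average {2}/Ref pw /= subr0 /Ref /F /= subr0.
  by rewrite (lintZ c 0 l lw) mulrA.
have := nrm2_ge0 mu (Imf D).
move: H; rewrite /energy E => H1 H2.
have H3 : c ^+ 2 * nrm2 mu (fun w => lint (orb f w) 0 l / l) < 4^-1 by lra.
have : nrm2 mu f * (c ^+ 2 * nrm2 mu (fun w => lint (orb f w) 0 l / l)) <= nrm2 mu f * 4^-1.
  by rewrite ler_pM2l// ltW.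
rewrite mulrA [nrm2 mu f * _]mulrC c2 mul1r; lra.
Qed.

End main_directions.

Section embedding.
Context d (Omega : measurableType d) (R : realType) (mu : probability Omega R).

(** Follow the isomorphism with the model by an injection of the line into [0, 1]
built from the arctangent. *)
Lemma lebesgue_space_embedding : lebesgue_space mu ->
  exists (u : Omega -> R) (N : set Omega),
  [/\ measurable_fun setT u, (forall w, 0 <= u w <= 1), mu.-negligible N &
    (forall w w', ~ N w -> ~ N w' -> u w = u w' -> w = w')].
Proof.
move=> [mu_complete [a [p [N [M [phi [N0 _ phibij phim _]]]]]]].
pose psi w : R := if w \in N then 0 else phi w.
have mN : measurable N by exact: mu_complete.
have mpsi : measurable_fun setT psi.
  move=> _ B mB; rewrite setTI.
  rewrite (_ : psi @^-1` B = (phi @^-1` B `\` N) `|` (if 0 \in B then N else set0)).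
    apply: measurableU; last by case: ifPn.
    by have [] := phim B mB.
  apply/seteqP; split => w; rewrite /psi /=.
    case: ifPn => [/set_mem wN B0|/negP wN Bw].
      by right; rewrite mem_set.
    by left; split => // /mem_set.
  case=> [[Bw nw]|]; first by rewrite memNset.
  by case: ifPn => // /set_mem B0 wN; rewrite mem_set.
pose u w := 2^-1 + atan (psi w) / pi : R.
have pi0 : 0 < pi :> R by exact: pi_gt0.
exists u, N; split => //.
- apply: measurable_funD => //; apply: measurable_funM => //.
  apply: measurableT_comp => //; apply: continuous_measurable_fun.
  exact: continuous_atan.
- move=> w; have h1 := atan_gtNpi2 (psi w); have h2 := atan_ltpi2 (psi w).
  have h3 : - 2^-1 < atan (psi w) / pi by rewrite ltr_pdivlMr//; lra.
  have h4 : atan (psi w) / pi < 2^-1 by rewrite ltr_pdivrMr//; lra.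
  by apply/andP; split; rewrite /u; lra.
- move=> w w' nw nw' /addrI /(mulIf _) => /(_ (invr_neq0 (lt0r_neq0 pi0))).
  move=> /(congr1 (@tan R)); rewrite !atanK /psi !memNset//.
  by case: phibij => _ + _; apply; rewrite inE.
Qed.
End embedding.

Theorem mainTheorem6 (R : realType) (d : measure_display)
    (Omega : measurableType d) (mu : probability Omega R)
    (T : R -> Omega -> Omega)
    (hLebesgue : lebesgue_space mu) (hNonAtomic : non_atomic mu)
    (hFlow : measure_flow mu T) :
  uniform_ergodic mu T <-> in_Linfty mu (period T).
Proof.
have [mu_complete _] := hLebesgue.
split; last exact: bounded_period_uniform.
move=> /(uniform_gap mu_complete hFlow)[l l0 gap].
have [u [N [mu_u u01 N0 u_inj]]] := lebesgue_space_embedding hLebesgue.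
exact: (period_bounded mu_complete hFlow mu_u u01 N0 u_inj l0 gap).
Qed.
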